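(* The set $A=\{Y\in\mathrm{SB}: Y\cong \ell_1\}$ is an analytic subset of $\mathrm{SB}$, but the set $$A_*=\{X\in\mathrm{SB}: \exists Y\in A \text{ with } X^*\cong Y\}=\{X\in\mathrm{SB}: X^*\cong \ell_1\}$$ is not analytic.
   Context: $C(2^{\mathbb{N}})$ is the Banach space of continuous real-valued functions on the Cantor set $2^{\mathbb{N}}$ with the supremum norm. $\mathrm{SB}$ denotes the set of all closed linear subspaces of $C(2^{\mathbb{N}})$, endowed with the relative Effros-Borel structure, i.e. the $\sigma$-algebra generated by the sets $\{X\in\mathrm{SB}: X\cap U\neq\varnothing\}$, with $U$ ranging over the open subsets of $C(2^{\mathbb{N}})$. With this structure $\mathrm{SB}$ is a standard Borel space, and every separable Banach space is isometric to a member of $\mathrm{SB}$. $X\cong Y$ means that $X$ and $Y$ are linearly isomorphic (i.e. there is a linear homeomorphism between them). A subset of a standard Borel space is analytic if it is the image of a standard Borel space under a Borel map. *)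

(* Defs.v *)
From HB Require Import structures.
From mathcomp Require Import all_boot all_order all_algebra.
From mathcomp Require Import all_classical all_reals all_analysis.

Set Implicit Arguments.
Unset Strict Implicit.
Unset Printing Implicit Defensive.

Import Order.TTheory GRing.Theory Num.Theory.
Import numFieldNormedType.Exports.

Local Open Scope classical_set_scope.
Local Open Scope ring_scope.

(** [ccantor R] is C(2^N) with the sup norm; it is made a subtype of
    [cantor_space -> R] so that its linear structure is the pointwise one. *)
Definition ccantor (R : realType) : Type := continuousType cantor_space R.

Section ccantor.
Context {R : realType}.

Definition ccantor_fun (f : ccantor R) : cantor_space -> R := f.

Definition ccantor_pred : {pred cantor_space -> R} :=
  mem [set f : cantor_space -> R | continuous f].

Definition ccantor_Sub (f : cantor_space -> R) (fP : f \in ccantor_pred) :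
  ccantor R := mkcts (set_mem fP : continuous f).

Lemma ccantor_rect (K : ccantor R -> Type) :
  (forall f (Pf : f \in ccantor_pred), K (ccantor_Sub Pf)) -> forall u, K u.
Proof.
move=> Ksub [f [[cf]]].
have Pf : f \in ccantor_pred by rewrite inE.
have -> : cf = set_mem Pf by exact: Prop_irrelevance.
exact: Ksub.
Qed.

Lemma ccantor_SubK f (Pf : f \in ccantor_pred) :
  ccantor_fun (ccantor_Sub Pf) = f.
Proof. by []. Qed.

HB.instance Definition _ := Choice.on (ccantor R).
HB.instance Definition _ :=
  isSub.Build _ _ (ccantor R) ccantor_rect ccantor_SubK.

Lemma ccantor_submod_closed : submod_closed ccantor_pred.
Proof.
split; first by rewrite inE; apply: cst_continuous.
move=> a f g; rewrite !inE => cf cg x.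
suff : (fun y => a * f y + g y) @ x --> a * f x + g x by [].
by apply: cvgD; [apply: cvgM; [exact: cvg_cst|exact: cf]|exact: cg].
Qed.

HB.instance Definition _ := GRing.isSubmodClosed.Build _ _ ccantor_pred
  ccantor_submod_closed.
HB.instance Definition _ := [SubChoice_isSubLmodule of ccantor R by <:].

Definition sup_norm (f : ccantor R) : R :=
  sup [set `|ccantor_fun f x| | x in [set: cantor_space]].

Lemma has_sup_norm (f : ccantor R) :
  has_sup [set `|ccantor_fun f x| | x in [set: cantor_space]].
Proof.
split; first by exists `|ccantor_fun f point|, point.
have cf : continuous (fun x : cantor_space => `|ccantor_fun f x|).
  by move=> x; apply: cvg_norm; exact: cts_fun.
have /compact_bounded [M [_ /(_ (M + 1))]] :
    compact ((fun x : cantor_space => `|ccantor_fun f x|) @` setT).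
  apply: continuous_compact; last exact: cantor_space_compact.
  exact: continuous_subspaceT.
move=> /(_ (ltr_pwDr ltr01 (lexx _))) H; exists (M + 1) => _ [x _ <-].
by rewrite -normr_id; apply: H; exists x.
Qed.

Lemma le_sup_norm (f : ccantor R) x : `|ccantor_fun f x| <= sup_norm f.
Proof. by apply: (sup_upper_bound (has_sup_norm f)); exists x. Qed.

Lemma sup_norm_le (f : ccantor R) M :
  (forall x, `|ccantor_fun f x| <= M) -> sup_norm f <= M.
Proof.
move=> fM; apply: ge_sup; first by have [] := has_sup_norm f.
by move=> _ [x _ <-].
Qed.

Lemma sup_normD f g : sup_norm (f + g) <= sup_norm f + sup_norm g.
Proof.
apply: sup_norm_le => x.
have -> : ccantor_fun (f + g) x = ccantor_fun f x + ccantor_fun g x by [].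
by rewrite (le_trans (ler_normD _ _))// lerD// le_sup_norm.
Qed.

Lemma sup_normZ (a : R) f : sup_norm (a *: f) = `|a| * sup_norm f.
Proof.
have ZE b h x : ccantor_fun (b *: h) x = b * ccantor_fun h x by [].
have le b h : sup_norm (b *: h) <= `|b| * sup_norm h.
  by apply: sup_norm_le => x; rewrite ZE normrM ler_wpM2l// le_sup_norm.
apply/eqP; rewrite eq_le le/=.
have [->|a0] := eqVneq a 0.
  rewrite normr0 mul0r.
  by apply: (le_trans (normr_ge0 (ccantor_fun (0 *: f) point))); exact: le_sup_norm.
rewrite -ler_pdivlMl ?normr_gt0// -normfV.
by have := le a^-1 (a *: f); rewrite scalerA mulVf// scale1r.
Qed.

Lemma sup_norm_eq0 f : sup_norm f = 0 -> f = 0.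
Proof.
move=> f0; apply: val_inj; apply/funext => x.
by apply/eqP; rewrite -normr_le0 -f0; exact: le_sup_norm.
Qed.

HB.instance Definition _ := Lmodule_isNormed.Build R (ccantor R)
  sup_normD sup_normZ sup_norm_eq0.

End ccantor.

Record closed_subspace (R : realType) (V : normedModType R) :=
  ClosedSubspace {
    csub_set :> set V ;
    csub_submod : submod_closed (mem csub_set) ;
    csub_closed : closed csub_set }.

HB.instance Definition _ (R : realType) (V : normedModType R) :=
  gen_eqMixin (closed_subspace V).
HB.instance Definition _ (R : realType) (V : normedModType R) :=
  gen_choiceMixin (closed_subspace V).

Section closed_subspace.
Context {R : realType} {V : normedModType R}.
Implicit Type X : closed_subspace V.

Lemma submod_closed_setT : submod_closed (mem [set: V]).
Proof. by split=> [|a u v _ _]; rewrite inE. Qed.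

HB.instance Definition _ := isPointed.Build (closed_subspace V)
  (ClosedSubspace submod_closed_setT closedT).

Definition csub_pred X : {pred V} := mem (csub_set X).

HB.instance Definition _ X := GRing.isSubmodClosed.Build R V (csub_pred X)
  (csub_submod X).

Record csub_type X := CsubType {
  csub_val :> V ;
  csub_valP : csub_val \in csub_pred X }.

HB.instance Definition _ X := [isSub for @csub_val X].
HB.instance Definition _ X := [Choice of csub_type X by <:].
HB.instance Definition _ X := [SubChoice_isSubLmodule of csub_type X by <:].

Definition csub_norm X (x : csub_type X) : R := `|csub_val x|.

Lemma csub_normD X (x y : csub_type X) :
  csub_norm (x + y) <= csub_norm x + csub_norm y.
Proof. exact: ler_normD. Qed.

Lemma csub_normZ X (a : R) (x : csub_type X) :
  csub_norm (a *: x) = `|a| * csub_norm x.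
Proof. exact: normrZ. Qed.

Lemma csub_norm_eq0 X (x : csub_type X) : csub_norm x = 0 -> x = 0.
Proof. by move=> /normr0_eq0 x0; exact: val_inj. Qed.

HB.instance Definition _ X := Lmodule_isNormed.Build R (csub_type X)
  (@csub_normD X) (@csub_normZ X) (@csub_norm_eq0 X).

End closed_subspace.

(** Generators of the Effros-Borel structure. *)
Definition effros (R : realType) (V : normedModType R) :
    set (set (closed_subspace V)) :=
  [set [set X : closed_subspace V | csub_set X `&` U !=set0]
    | U in [set U : set V | open U]].
Arguments effros {R} V _.

Definition SB (R : realType) : measurableType (effros (ccantor R)).-sigma :=
  g_sigma_algebraType (effros (ccantor R)).

Section dual.
Context {R : realType} {V : normedModType R}.

Definition dual_pred : {pred V -> R} :=
  mem [set f : V -> R | linear f /\ continuous f].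

Record dual := Dual {
  dual_fun :> V -> R ;
  dual_funP : dual_fun \in dual_pred }.

HB.instance Definition _ := [isSub for dual_fun].
HB.instance Definition _ := [Choice of dual by <:].

Lemma dual_submod_closed : submod_closed dual_pred.
Proof.
split.
  rewrite inE; split; last exact: cst_continuous.
  by move=> a x y /=; rewrite scaler0 addr0.
move=> a f g; rewrite !inE => -[lf cf] [lg cg]; split.
  move=> b x y.
  have E z : (a *: f + g) z = a *: f z + g z by [].
  by rewrite !E lf lg !scalerDr !scalerA (mulrC a b) addrACA.
move=> x.
suff : (fun y => a * f y + g y) @ x --> a * f x + g x by [].
by apply: cvgD; [apply: cvgM; [exact: cvg_cst|exact: cf]|exact: cg].
Qed.

HB.instance Definition _ := GRing.isSubmodClosed.Build R _ dual_pred
  dual_submod_closed.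
HB.instance Definition _ := [SubChoice_isSubLmodule of dual by <:].

Definition dual_norm (f : dual) : R :=
  sup [set `|f x| | x in [set x : V | `|x| <= 1]].

Lemma has_dual_norm (f : dual) :
  has_sup [set `|f x| | x in [set x : V | `|x| <= 1]].
Proof.
split; first by exists `|f 0|, 0 => //=; rewrite normr0.
have := dual_funP f; rewrite inE => -[lf cf].
pose F : {linear V -> R} :=
  HB.pack (dual_fun f) (GRing.isLinear.Build _ _ _ _ (dual_fun f) lf).
have /(linear_bounded_continuous F)/linear_boundedP : continuous F by [].
move=> /pinfty_ex_gt0 [M M0 FM]; exists M => _ [x /= x1 <-].
by rewrite (le_trans (FM x))// ler_piMr// ltW.
Qed.

Lemma le_dual_norm (f : dual) x : `|x| <= 1 -> `|f x| <= dual_norm f.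
Proof. by move=> x1; apply: (sup_upper_bound (has_dual_norm f)); exists x. Qed.

Lemma dual_norm_le (f : dual) M :
  (forall x, `|x| <= 1 -> `|f x| <= M) -> dual_norm f <= M.
Proof.
move=> fM; apply: ge_sup; first by have [] := has_dual_norm f.
by move=> _ [x /= x1 <-]; exact: fM.
Qed.

Lemma dual_normD f g : dual_norm (f + g) <= dual_norm f + dual_norm g.
Proof.
apply: dual_norm_le => x x1.
have -> : (f + g : dual) x = f x + g x by [].
by rewrite (le_trans (ler_normD _ _))// lerD// le_dual_norm.
Qed.

Lemma dual_normZ (a : R) f : dual_norm (a *: f) = `|a| * dual_norm f.
Proof.
have ZE b (h : dual) x : (b *: h : dual) x = b * h x by [].
have le b h : dual_norm (b *: h) <= `|b| * dual_norm h.
  by apply: dual_norm_le => x x1; rewrite ZE normrM ler_wpM2l// le_dual_norm.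
apply/eqP; rewrite eq_le le/=.
have [->|a0] := eqVneq a 0.
  rewrite normr0 mul0r.
  apply: (le_trans (normr_ge0 ((0 *: f : dual) 0))).
  by apply: le_dual_norm; rewrite normr0.
rewrite -ler_pdivlMl ?normr_gt0// -normfV.
by have := le a^-1 (a *: f); rewrite scalerA mulVf// scale1r.
Qed.

Lemma dual_norm_eq0 f : dual_norm f = 0 -> f = 0.
Proof.
move=> f0; apply: val_inj; apply/funext => x /=.
have := dual_funP f; rewrite inE => -[lf _].
have fZ a y : f (a *: y) = a *: f y.
  have f00 : f 0 = 0.
    have := lf 1 0 0; rewrite scaler0 addr0 scale1r => /eqP.
    by rewrite -subr_eq0 opprD addrA subrr sub0r oppr_eq0 => /eqP.
  by have := lf a y 0; rewrite addr0 f00 addr0.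
have [->|x0] := eqVneq x 0; first by rewrite -(scale0r 0) fZ scale0r.
have : `|f (`|x|^-1 *: x)| <= 0.
  rewrite -f0; apply: le_dual_norm.
  by rewrite normrZ normfV normr_id mulVf// normr_eq0.
rewrite fZ normr_le0 scaler_eq0 invr_eq0 normr_eq0 (negbTE x0)/=.
by move/eqP.
Qed.

HB.instance Definition _ := Lmodule_isNormed.Build R dual
  dual_normD dual_normZ dual_norm_eq0.

End dual.
Arguments dual {R} V.

Section ell1.
Context {R : realType}.

Definition ell1_pred : {pred nat -> R} :=
  mem [set u : R^nat | cvgn [normed series u]].

Record ell1 := Ell1 {
  ell1_seq :> nat -> R ;
  ell1_seqP : ell1_seq \in ell1_pred }.

HB.instance Definition _ := [isSub for ell1_seq].
HB.instance Definition _ := [Choice of ell1 by <:].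

Lemma normed_seriesZ (a : R) (u : R^nat) :
  [normed series (a *: u)] = `|a| *: [normed series u].
Proof.
apply/funext => n; rewrite /series/=.
have -> : (`|a| *: (fun n => \sum_(0 <= k < n) `|u k|)) n =
          `|a| * \sum_(0 <= k < n) `|u k| by [].
rewrite mulr_sumr; apply: eq_bigr => k _.
by have -> : (a *: u) k = a * u k by []; rewrite normrM.
Qed.

Lemma nondecreasing_normed_series (u : R^nat) :
  nondecreasing_seq [normed series u].
Proof. by apply: nondecreasing_series => n _ _ /=. Qed.

Lemma normed_seriesD (u v : R^nat) n :
  [normed series (u + v)] n <= [normed series u] n + [normed series v] n.
Proof.
rewrite /series/= -big_split/=; apply: ler_sum => k _; exact: ler_normD.
Qed.

Lemma is_cvg_normed_seriesD (u v : R^nat) : cvgn [normed series u] ->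
  cvgn [normed series v] -> cvgn [normed series (u + v)].
Proof.
move=> cu cv; apply: nondecreasing_is_cvgn; first exact: nondecreasing_normed_series.
exists (limn [normed series u] + limn [normed series v]) => _ [n _ <-].
rewrite (le_trans (normed_seriesD _ _ _))// lerD//;
  by apply: nondecreasing_cvgn_le => //; exact: nondecreasing_normed_series.
Qed.

Lemma ell1_submod_closed : submod_closed ell1_pred.
Proof.
split.
  rewrite inE /=.
  have -> : [normed series (0 : R^nat)] = cst 0.
    by apply/funext => n; rewrite /series/=; apply: big1 => k _; rewrite normr0.
  exact: is_cvg_cst.
move=> a u v; rewrite !inE => cu cv; apply: is_cvg_normed_seriesD => //.
rewrite normed_seriesZ; apply: (cvgP (`|a| * limn [normed series u])).
by apply: cvgM; [exact: cvg_cst|exact: cu].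
Qed.

HB.instance Definition _ := GRing.isSubmodClosed.Build R _ ell1_pred
  ell1_submod_closed.
HB.instance Definition _ := [SubChoice_isSubLmodule of ell1 by <:].

Definition ell1_norm (u : ell1) : R := limn [normed series (ell1_seq u)].

Lemma ell1_cvg (u : ell1) : cvgn [normed series (ell1_seq u)].
Proof. by have := ell1_seqP u; rewrite inE. Qed.

Lemma ell1_normD u v : ell1_norm (u + v) <= ell1_norm u + ell1_norm v.
Proof.
rewrite /ell1_norm; apply: (limr_le (@ell1_cvg (u + v)) _).
apply: nearW => n; rewrite (le_trans (normed_seriesD _ _ _))// lerD//;
  by apply: nondecreasing_cvgn_le;
     [exact: nondecreasing_normed_series|exact: ell1_cvg].
Qed.

Lemma ell1_normZ (a : R) u : ell1_norm (a *: u) = `|a| * ell1_norm u.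
Proof.
rewrite /ell1_norm (normed_seriesZ a u).
by apply/cvg_lim => //; apply: cvgM; [exact: cvg_cst|exact: ell1_cvg].
Qed.

Lemma ell1_norm_eq0 u : ell1_norm u = 0 -> u = 0.
Proof.
move=> u0; apply: val_inj; apply/funext => n /=.
apply/eqP; rewrite -normr_le0 -u0.
have := nondecreasing_cvgn_le (@nondecreasing_normed_series u) (@ell1_cvg u) n.+1.
apply: le_trans; rewrite /normed_series_of seriesSr lerDr.
by rewrite /series/=; apply: sumr_ge0.
Qed.

HB.instance Definition _ := Lmodule_isNormed.Build R ell1
  ell1_normD ell1_normZ ell1_norm_eq0.

End ell1.
Arguments ell1 R : clear implicits.

Definition isomorphic (R : realType) (V W : normedModType R) : Prop :=
  exists f : {linear V -> W}, continuous f /\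
    exists g : W -> V, [/\ cancel f g, cancel g f & continuous g].

Definition separable_space (T : topologicalType) : Prop :=
  exists2 D : set T, countable D & dense D.

(** The sigma-algebra of [T] is the Borel sigma-algebra of a Polish space [P],
    transported along the bijection [phi]. A Hausdorff complete pseudometric
    space is a complete metric space. *)
Definition standard_borel (R : realType) d (T : measurableType d) : Prop :=
  exists (P : completePseudoMetricType R) (phi : T -> P),
    [/\ hausdorff_space P, separable_space P, bijective phi &
        @measurable d T = [set phi @^-1` B | B in <<s [set U : set P | open U] >>]].

(** Measurable types are pointed by definition, so the image of the empty
    standard Borel space has to be listed separately. *)
Definition analytic (R : realType) d (S : measurableType d) (A : set S) : Prop :=
  A = set0 \/
  exists (d' : measure_display) (T : measurableType d') (f : T -> S),
    [/\ standard_borel R T, measurable_fun [set: T] f & A = range f].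

(* Main.v *)
Require Import Defs.
From HB Require Import structures.
From mathcomp Require Import all_boot all_order all_algebra.
From mathcomp Require Import all_classical all_reals all_analysis.
From mathcomp Require Import ring lra.
Import Order.TTheory GRing.Theory Num.Theory.
Import numFieldNormedType.Exports.
Local Open Scope classical_set_scope.

(** The class of spaces isomorphic to ell1 is analytic because such a space is
the closed span of a bounded sequence [y] with [c * sum |a_i| <= |sum a_i y_i|]
([isomorphic_ell1_basis], [ell1_basis_isomorphic]).  Sequences of this kind,
given by approximations from a countable dense set, are coded by a closed subset
of the Baire space, and the closed span depends on the code in a Borel way: it
meets an open set [U] exactly when some rational combination of the [y_i] lies
in [U] ([cspan_meets]).  The Rademacher functions span an isometric copy of ell1
in C(2^N), so that [A_star] is the class of the preduals of ell1.

That [A_star] is not analytic is a self-reference argument on trees.  To a tree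
on the natural numbers is attached the closed span of the indicator functions of
a family of cylinders of the Cantor space, one for each node, nested as the nodes
are; sequences outside the tree contribute disjoint cylinders.  Every cylinder
comes with a point of it that lies in no smaller one.
- If the tree has no infinite branch, every functional is an absolutely
  convergent sum of point masses at these points, so the dual is ell1
  ([forest_dual], [tree_space_wf]).  The mass at a node is the value of the
  functional on its cylinder minus the values on the cylinders of its children,
  and the absence of branches is what allows the values to be recovered from the
  masses, by induction from the leaves.
- If the tree has uncountably many branches, the evaluations at the limit points
  of the branches form an uncountable family in the dual with mutual distances at
  least 1, and the separable space ell1 has no such family
  ([tree_space_branching]).

If [A_star] were analytic, the codes of the trees whose space has dual ell1 would
form a Souslin set [E], the projection of a closed set [C] ([analytic_souslin]).
The tree whose nodes are the finite pieces of witnesses that its own code belongs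
to [E] is well defined: whether a sequence is a node involves only the part of the
code that concerns shorter sequences ([diagonal_tree]).  Witnesses are read on the
even coordinates and the odd ones are free, so this tree has either no branch or
uncountably many.  If the dual of its space is ell1, its code is in [E], there are
uncountably many branches, and the dual is not ell1; if the dual is not ell1,
there is no branch, and the dual is ell1. *)

Set Implicit Arguments.
Unset Strict Implicit.
Unset Printing Implicit Defensive.

Notation baire := (nat -> nat).

(** * Souslin sets of the Baire space *)

Section souslin_sets.
Local Open Scope nat_scope.

Definition agree n (x y : baire) := forall i, i < n -> x i = y i.

Lemma agree_le m n x y : m <= n -> agree n x y -> agree m x y.
Proof. by move=> mn xy i im; apply: xy; exact: leq_trans mn. Qed.

(** The closed subsets of the product of two copies of the Baire space. *)
Definition seq_closed (C : baire -> baire -> Prop) := forall z x,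
  (forall n, exists z' x', [/\ agree n z z', agree n x x' & C z' x']) -> C z x.

Definition souslin (E : baire -> Prop) :=
  exists2 C, seq_closed C & forall z, E z <-> exists x, C z x.

(** Continuity in both arguments, in terms of initial segments. *)
Definition continuous2 (phi : baire -> baire -> baire) := forall n, exists m,
  forall z z' x x', agree m z z' -> agree m x x' -> agree n (phi z x) (phi z' x').

Lemma seq_closed_comp C phi psi : seq_closed C -> continuous2 phi ->
  continuous2 psi -> seq_closed (fun z x => C (phi z x) (psi z x)).
Proof.
move=> cC cphi cpsi z x zx; apply: cC => n.
have [m1 H1] := cphi n; have [m2 H2] := cpsi n.
have [z' [x' [zz' xx' Czx']]] := zx (maxn m1 m2).
exists (phi z' x'), (psi z' x'); split=> //.
  by apply: H1; apply: agree_le; try eassumption; exact: leq_maxl.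
by apply: H2; apply: agree_le; try eassumption; exact: leq_maxr.
Qed.

Lemma bounded_prefix (f : nat -> nat) n : exists m, forall i, i < n -> f i < m.
Proof.
exists (\max_(i < n) f i).+1 => i ilt; rewrite ltnS.
exact: (leq_bigmax (Ordinal ilt)).
Qed.

Lemma continuous2_left f : continuous2 (fun z _ i => z (f i)).
Proof.
move=> n; have [m H] := bounded_prefix f n.
by exists m => z z' x x' zz' _ i /H; exact: zz'.
Qed.

Lemma continuous2_right f : continuous2 (fun _ x i => x (f i)).
Proof.
move=> n; have [m H] := bounded_prefix f n.
by exists m => z z' x x' _ xx' i /H; exact: xx'.
Qed.

Definition interleave (x y : baire) : baire :=
  fun i => if odd i then y i./2 else x i./2.

Lemma interleave_even x y i : interleave x y i.*2 = x i.
Proof. by rewrite /interleave odd_double doubleK. Qed.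

Lemma interleave_odd x y i : interleave x y i.*2.+1 = y i.
Proof. by rewrite /interleave /= odd_double /= uphalf_double. Qed.

Lemma continuous2_interleave phi psi : continuous2 phi -> continuous2 psi ->
  continuous2 (fun z x => interleave (phi z x) (psi z x)).
Proof.
move=> cphi cpsi n; have [m1 H1] := cphi n; have [m2 H2] := cpsi n.
exists (maxn m1 m2) => z z' x x' zz' xx' i ni.
have ni2 : i./2 < n.
  rewrite (leq_ltn_trans _ ni)// -[leqRHS](odd_double_half i).
  by rewrite -addnn addnA leq_addl.
rewrite /interleave; case: ifP => _.
  by apply: H2 ni2; apply: agree_le; try eassumption; exact: leq_maxr.
by apply: H1 ni2; apply: agree_le; try eassumption; exact: leq_maxl.
Qed.

(** [row k] and [unrows] identify a point of the Baire space with a sequence of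
    such points. *)
Definition row (k : nat) (x : baire) : baire := fun i => x (pickle (k, i)).

Definition unrows (x : nat -> baire) : baire :=
  fun n => if unpickle n is Some (k, i) then x k i else 0.

Lemma unrowsK x k : row k (unrows x) = x k.
Proof. by apply/funext => i; rewrite /row /unrows pickleK. Qed.

Lemma souslin_closed (E : baire -> Prop) :
  (forall z, (forall n, exists2 z', agree n z z' & E z') -> E z) -> souslin E.
Proof.
move=> cE; exists (fun z _ => E z).
  by move=> z x zx; apply: cE => n; have [z' [x' [? _ ?]]] := zx n; exists z'.
by move=> z; split=> [Ez|[]//]; exists z.
Qed.

(** A witness only has to name, in its first value, the length of an initial
    segment that determines membership. *)
Lemma souslin_open (E : baire -> Prop) :
  (forall z, E z -> exists n, forall z', agree n z z' -> E z') -> souslin E.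
Proof.
move=> oE; exists (fun z x => forall z', agree (x 0) z z' -> E z').
  move=> z x zx z' zz'; have [z1 [x1 [zz1 xx1 E1]]] := zx (x 0).+1.
  apply: E1 => i; rewrite -(xx1 0)// => ix.
  by rewrite -zz1 ?zz'// (leq_trans ix).
move=> z; split=> [/oE[n zn]|[x]]; first by exists (fun _ => n).
by apply.
Qed.

Lemma souslin_family (E : nat -> baire -> Prop) : (forall k, souslin (E k)) ->
  exists2 C : nat -> baire -> baire -> Prop, forall k, seq_closed (C k) &
    forall k z, E k z <-> exists x, C k z x.
Proof.
move=> sE; have /choice[C HC] k : exists C,
    seq_closed C /\ forall z, E k z <-> exists x, C z x.
  by have [C cC CE] := sE k; exists C.
by exists C => k; have [] := HC k.
Qed.

(** A witness for an intersection stores in its rows a witness for each set. *)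
Lemma souslin_cap (E : nat -> baire -> Prop) :
  (forall k, souslin (E k)) -> souslin (fun z => forall k, E k z).
Proof.
move=> /souslin_family[C cC CE].
exists (fun z x => forall k, C k z (row k x)).
  move=> z x zx k.
  apply: (seq_closed_comp (cC k) (continuous2_left id)
     (continuous2_right (fun i => pickle (k, i)))) => n.
  by have [z' [x' [? ? H]]] := zx n; exists z', x'; split=> //; exact: H.
move=> z; split=> [Ez|[x Cx] k]; last by apply/CE; exists (row k x).
have /choice[x Cx] k : exists x, C k z x by apply/CE.
by exists (unrows x) => k; rewrite unrowsK.
Qed.

(** The first value of a witness for a union selects one of the sets. *)
Lemma souslin_cup (E : nat -> baire -> Prop) :
  (forall k, souslin (E k)) -> souslin (fun z => exists k, E k z).
Proof.
move=> /souslin_family[C cC CE].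
exists (fun z x => C (x 0) z (fun i => x i.+1)).
  move=> z x zx; apply: cC => n.
  have [z' [x' [zz' xx' H]]] := zx n.+1.
  exists z', (fun i => x' i.+1); split.
  - exact: agree_le zz'.
  - by move=> i ni; exact: xx'.
  - by rewrite xx'.
move=> z; split=> [[k /CE[x Cx]]|[x Cx]]; last first.
  by exists (x 0); apply/CE; exists (fun i => x i.+1).
by exists (fun i => if i is j.+1 then x j else k).
Qed.

Lemma souslin_ext E E' : (forall z, E z <-> E' z) -> souslin E -> souslin E'.
Proof.
move=> EE' [C cC CE]; exists C => // z; rewrite -CE; split=> /EE'//.
Qed.

Lemma souslinI E E' : souslin E -> souslin E' -> souslin (fun z => E z /\ E' z).
Proof.
move=> sE sE'.
apply: (@souslin_ext (fun z => forall k, (if k is 0 then E else E') z)).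
  move=> z; split=> [H|[? ?] [|k]//]; split; [exact: (H 0)|exact: (H 1)].
by apply: (@souslin_cap (fun k => if k is 0 then E else E')) => -[].
Qed.

Lemma souslinU E E' : souslin E -> souslin E' -> souslin (fun z => E z \/ E' z).
Proof.
move=> sE sE'.
apply: (@souslin_ext (fun z => exists k, (if k is 0 then E else E') z)).
  move=> z; split=> [[[|k] H]|[H|H]]; [by left|by right|by exists 0|by exists 1].
by apply: (@souslin_cup (fun k => if k is 0 then E else E')) => -[].
Qed.

Lemma souslin_reindex E f : souslin E -> souslin (fun z => E (fun i => z (f i))).
Proof.
move=> [C cC CE]; exists (fun z x => C (fun i => z (f i)) x) => // z x zx.
exact: (seq_closed_comp cC (continuous2_left f) (continuous2_right id)).
Qed.

Lemma souslin_proj G : souslin G -> souslin (fun z => exists y, G (interleave z y)).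
Proof.
move=> [C cC CG].
exists (fun z x => C (interleave z (fun i => x i.*2)) (fun i => x i.*2.+1)).
  apply: (seq_closed_comp (phi := fun z x => interleave z (fun i => x i.*2))
    (psi := fun _ x i => x i.*2.+1) cC); last exact: continuous2_right.
  apply: (continuous2_interleave (phi := fun z _ => z)
    (psi := fun _ x i => x i.*2)); last exact: continuous2_right.
  exact: (continuous2_left id).
move=> z; split=> [[y /CG[x Cx]]|[x Cx]]; last first.
  by exists (fun i => x i.*2); apply/CG; exists (fun i => x i.*2.+1).
exists (interleave y x).
rewrite (_ : (fun i => _) = y); last by apply/funext => i; rewrite interleave_even.
rewrite (_ : (fun i => interleave y x i.*2.+1) = x)//.
by apply/funext => i; rewrite interleave_odd.
Qed.

(** * A tree that refers to its own code *)
Section diagonal.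

(** The sequence numbered [i] has length at most [i], so the first [n] values
    of the code of a tree concern sequences of length less than [n] only. *)
Lemma size_code s : size s <= CodeSeq.code s.
Proof.
elim: s => //= n s IH; apply: (@leq_trans (CodeSeq.code s).*2.+1).
  by rewrite ltnS (leq_trans IH)// -addnn leq_addr.
by rewrite leq_pmull// expn_gt0.
Qed.

Lemma size_decode i : size (CodeSeq.decode i) <= i.
Proof. by rewrite -{2}(CodeSeq.decodeK i) size_code. Qed.

Definition tree_code (T : seq nat -> Prop) : baire :=
  fun i => `[< T (CodeSeq.decode i) >].

Definition branch (T : seq nat -> Prop) (x : baire) :=
  forall n, T (mkseq x n).

(** Let [E] be the projection of the closed set [C].  A sequence is put in [T] when
    it is compatible with some pair in [C] whose first component agrees with the
    code of [T] up to the length of the sequence; this is a legitimate recursion on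
    the length.  A branch of [T] gives, as [C] is closed, a witness that the code of
    [T] is in [E], and the odd values of a branch are unconstrained. *)
Lemma diagonal_tree (E : baire -> Prop) : souslin E ->
  exists T : seq nat -> Prop, [/\
    forall s n, T s -> T (take n s),
    E (tree_code T) -> exists x, forall y, branch T (interleave x y) &
    ~ E (tree_code T) -> forall x, ~ branch T x].
Proof.
move=> [C cC CE].
(* One step of the recursion; [T] is its fixed point. *)
pose Phi (T : seq nat -> Prop) s := exists z' x',
  [/\ agree (size s) (tree_code T) z',
      forall i, i.*2 < size s -> nth 0 s i.*2 = x' i & C z' x'].
have Phi_ext T T' s : (forall u, size u < size s -> T u <-> T' u) ->
    Phi T s -> Phi T' s.
  move=> TT' [z' [x' [Hz Hx Czx]]]; exists z', x'; split=> // i ilt.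
  rewrite -Hz// /tree_code; congr (nat_of_bool _); apply: asbool_equiv_eq.
  by apply: iff_sym; apply: TT'; rewrite (leq_ltn_trans (size_decode i)).
pose Tn k := iter k Phi (fun _ => False).
pose T s := Tn (size s).+1 s.
have TnE k : forall s, size s < k -> Tn k s <-> T s.
  elim/ltn_ind: k => -[//|k] IH s sk.
  have H : forall u, size u < size s -> Tn k u <-> Tn (size s) u.
    move=> u us; rewrite (IH k)//; last by rewrite (leq_trans us).
    by rewrite (IH (size s)).
  by split; apply: Phi_ext => u us; [|apply: iff_sym]; exact: H.
have TE s : T s <-> Phi T s.
  by split; apply: Phi_ext => u us; [|apply: iff_sym]; exact: TnE.
(* A node of length [2 * n] determines [n] values of a witness. *)
have T_closed x : branch T x -> C (tree_code T) (fun i => x i.*2).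
  move=> bx; apply: cC => n.
  have /TE[z' [x' [Hz Hx Czx]]] := bx n.*2.
  rewrite size_mkseq in Hz Hx.
  exists z', x'; split=> //.
    by apply: agree_le Hz; rewrite -addnn leq_addr.
  move=> i ni; have i2 : i.*2 < n.*2 by rewrite ltn_double.
  by rewrite -Hx// nth_mkseq.
exists T; split.
- move=> s n /TE[z' [x' [Hz Hx Czx]]]; apply/TE; exists z', x'.
  have szt : size (take n s) <= size s by rewrite size_take_min geq_minr.
  split=> //; first exact: agree_le Hz.
  move=> i ilt; rewrite nth_take ?Hx// ?(leq_trans ilt)//.
  by rewrite size_take_min geq_minl.
- move=> /CE[x Cx]; exists x => y n; apply/TE; exists (tree_code T), x.
  by split=> // i; rewrite size_mkseq => ni; rewrite nth_mkseq// interleave_even.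
- by move=> nE x /T_closed Cx; apply: nE; apply/CE; eexists; exact: Cx.
Qed.

End diagonal.

End souslin_sets.

Local Open Scope ring_scope.

(** * Linear isomorphisms *)
Section isomorphic.
Variable R : realType.
Implicit Types V W : normedModType R.

Lemma linear_bound_continuous V W (f : {linear V -> W}) (M : R) :
  (forall x, `|f x| <= M * `|x|) -> continuous f.
Proof.
move=> fM; apply/linear_bounded_continuous/linear_boundedP.
apply: (filterS _ (nbhs_pinfty_ge (num_real M))) => r Mr x.
by rewrite (le_trans (fM x))// ler_wpM2r.
Qed.

Lemma continuous_linear_bound V W (f : {linear V -> W}) : continuous f ->
  exists2 M : R, 0 < M & forall x, `|f x| <= M * `|x|.
Proof.
by move=> /linear_bounded_continuous/linear_boundedP/pinfty_ex_gt0[M M0 fM]; exists M.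
Qed.

Lemma isomorphic_bounded V W (f : {linear V -> W}) (g : W -> V) (M N : R) :
  cancel f g -> cancel g f -> (forall x, `|f x| <= M * `|x|) ->
  (forall y, `|g y| <= N * `|y|) -> isomorphic V W.
Proof.
move=> fK gK fM gN; exists f; split; first exact: linear_bound_continuous fM.
exists g; split=> //.
pose G : {linear W -> V} := HB.pack g (GRing.isLinear.Build _ _ _ _ g
  (can2_linear fK gK)).
exact: (@linear_bound_continuous _ _ G N gN).
Qed.

Lemma isomorphicP V W : isomorphic V W -> exists (f : {linear V -> W})
  (g : {linear W -> V}) (M : R), [/\ cancel f g, cancel g f, 0 < M,
    forall x, `|f x| <= M * `|x| & forall y, `|g y| <= M * `|y|].
Proof.
move=> [f [cf [g [fK gK cg]]]].
pose G : {linear W -> V} := HB.pack g (GRing.isLinear.Build _ _ _ _ g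
  (can2_linear fK gK)).
have [M M0 fM] := continuous_linear_bound cf.
have [N N0 gN] := @continuous_linear_bound _ _ G cg.
exists f, G, (M + N); split=> // [|x|x]; first exact: addr_gt0.
  by rewrite (le_trans (fM x))// ler_wpM2r// lerDl ltW.
by rewrite (le_trans (gN x))// ler_wpM2r// lerDr ltW.
Qed.

Lemma isomorphic_sym V W : isomorphic V W -> isomorphic W V.
Proof.
move=> /isomorphicP[f [g [M [fK gK M0 fM gM]]]].
exact: (isomorphic_bounded (f := g) (g := f) gK fK gM fM).
Qed.

Lemma isomorphic_trans V W Z : isomorphic V W -> isomorphic W Z -> isomorphic V Z.
Proof.
move=> /isomorphicP[f [g [M [fK gK M0 fM gM]]]].
move=> /isomorphicP[h [k [N [hK kK N0 hN kN]]]].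
have hfL : linear (h \o f) by move=> a u v /=; rewrite !linearP.
pose hf : {linear V -> Z} := HB.pack (h \o f) (GRing.isLinear.Build _ _ _ _ _ hfL).
apply: (isomorphic_bounded (f := hf) (g := g \o k) (M := N * M) (N := M * N)).
- by move=> x /=; rewrite hK fK.
- by move=> x /=; rewrite gK kK.
- by move=> x; rewrite (le_trans (hN _))// -mulrA ler_wpM2l// ltW.
- by move=> x; rewrite (le_trans (gM _))// -mulrA ler_wpM2l// ltW.
Qed.

End isomorphic.

(** * Rates of convergence *)
Section real_limits.
Variable R : realType.

Definition vanishing (e : nat -> R) :=
  forall d, 0 < d -> exists N, forall n, (N <= n)%N -> e n < d.

Lemma vanishing_harmonic : vanishing (fun n => n.+1%:R^-1).
Proof.
move=> d d0; have [N _ HN] := near_infty_natSinv_lt (PosNum d0).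
by exists N => n Nn; exact: HN.
Qed.

Lemma vanishingZ e (M : R) : (forall n, 0 <= e n) -> 0 <= M -> vanishing e ->
  vanishing (fun n => M * e n).
Proof.
move=> e0 M0 ve d d0; have M1 : 0 < M + 1 by rewrite ltr_wpDl.
have [N HN] := ve (d / (M + 1)) (divr_gt0 d0 M1).
exists N => n /HN; rewrite ltr_pdivlMr// => /(le_lt_trans _); apply.
by rewrite mulrC ler_wpM2l// lerDl.
Qed.

(** The limit is the supremum of the lower bounds [u n - e n]. *)
Lemma real_limit (u e : nat -> R) :
  (forall n m, (n <= m)%N -> `|u m - u n| <= e n) ->
  exists l, forall n, `|l - u n| <= e n.
Proof.
move=> ue.
have e0 n : 0 <= e n by rewrite (le_trans _ (ue n n (leqnn n))).
have ub n m : u n - e n <= u m + e m.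
  have [nm|/ltnW mn] := leqP n m.
    by have := ue _ _ nm; rewrite ler_norml; have := e0 m; lra.
  by have := ue _ _ mn; rewrite ler_norml; have := e0 n; lra.
pose S := range (fun n => u n - e n).
have supS : has_sup S.
  by split; [exists (u 0%N - e 0%N), 0%N|exists (u 0%N + e 0%N) => _ [n _ <-]].
exists (sup S) => n; rewrite ler_norml.
have : u n - e n <= sup S by apply: (sup_upper_bound supS); exists n.
have : sup S <= u n + e n.
  by apply: ge_sup => [|_ [m _ <-]//]; exact: supS.1.
lra.
Qed.

Lemma vanishing_cvg (u e : nat -> R) l : (forall n, `|l - u n| <= e n) ->
  vanishing e -> u @ \oo --> l.
Proof.
move=> ue ve; apply/cvgrPdist_le => d /ve[N HN]; exists N => // n /= Nn.
by rewrite (le_trans (ue n))// ltW// HN.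
Qed.

Lemma vanishing_eq0 (x : R) e : (forall n, x <= e n) -> vanishing e -> x <= 0.
Proof.
move=> xe ve; rewrite leNgt; apply/negP => /ve[N /(_ _ (leqnn _))].
by rewrite ltNge xe.
Qed.

End real_limits.

(** * The space ell1 *)
Section ell1_theory.
Variable R : realType.
Implicit Types (u v : ell1 R) (w : nat -> R).

Definition psum w n : R := \sum_(i < n) `|w i|.

Lemma psumE w : psum w = [normed series w].
Proof. by apply/funext => n; rewrite /psum /normed_series_of /series /= big_mkord. Qed.

Lemma psum_ge0 w n : 0 <= psum w n.
Proof. exact: sumr_ge0. Qed.

Lemma psum_le w m n : (m <= n)%N -> psum w m <= psum w n.
Proof. by move=> mn; rewrite psumE; exact: nondecreasing_normed_series. Qed.

Lemma ell1_psum_le u n : psum u n <= `|u|.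
Proof.
rewrite psumE; apply: nondecreasing_cvgn_le; last exact: ell1_cvg.
exact: nondecreasing_normed_series.
Qed.

Lemma ell1_norm_le u (M : R) : (forall n, psum u n <= M) -> `|u| <= M.
Proof.
move=> uM; apply: (limr_le (@ell1_cvg _ u)).
by apply: nearW => n; rewrite -psumE.
Qed.

Lemma ell1_tail u : vanishing (fun n => `|u| - psum u n).
Proof.
move=> d d0; have /cvgrPdist_lt/(_ d d0)[N _ HN] := @ell1_cvg _ u.
exists N => n /HN; apply: le_lt_trans; rewrite psumE.
exact: (@ler_norm R (`|u| - [normed series u] n)).
Qed.

Lemma psum_bounded_cvg w (M : R) : (forall n, psum w n <= M) -> cvgn [normed series w].
Proof.
move=> wM; apply: nondecreasing_is_cvgn; first exact: nondecreasing_normed_series.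
by exists M => _ [n _ <-]; rewrite -psumE.
Qed.

Lemma ell1_ex w (M : R) : (forall n, psum w n <= M) -> exists u, u =1 w.
Proof.
move=> wM; have wP : w \in ell1_pred by rewrite inE; exact: psum_bounded_cvg wM.
by exists (Ell1 wP).
Qed.

Lemma ell1_ext u v : u =1 v -> u = v.
Proof. by move=> uv; apply: val_inj; apply/funext. Qed.

Lemma ell1D u v i : (u + v) i = u i + v i. Proof. by []. Qed.
Lemma ell1N u i : (- u) i = - u i. Proof. by []. Qed.

Lemma ell1_coord_le u i : `|u i| <= `|u|.
Proof.
apply: le_trans (ell1_psum_le u i.+1); rewrite /psum big_ord_recr/= lerDr.
exact: psum_ge0.
Qed.

(** The limit is taken coordinatewise; the norm estimate first holds on finitely
    many coordinates, where the pointwise convergence is uniform. *)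
Lemma ell1_complete (u : nat -> ell1 R) e :
  (forall n m, (n <= m)%N -> `|u m - u n| <= e n) -> vanishing e ->
  exists l, forall n, `|l - u n| <= e n.
Proof.
move=> ue ve.
have /choice[l Hl] i : exists l, forall n, `|l - u n i| <= e n.
  by apply: real_limit => n m /ue; apply: le_trans; exact: (ell1_coord_le (u m - u n)).
have Hpsum n k : psum (fun i => l i - u n i) k <= e n.
  rewrite -subr_le0; apply: (@vanishing_eq0 _ _ (fun m => k%:R * e (n + m)%N)).
    move=> m; rewrite lerBlDl.
    apply: (@le_trans _ _ (psum (u (n + m)%N - u n) k + \sum_(i < k) e (n + m)%N)).
      rewrite /psum -big_split/=; apply: ler_sum => i _.
      have -> : l i - u n i = (u (n + m)%N - u n) i + (l i - u (n + m)%N i).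
        by rewrite ell1D ell1N; ring.
      by rewrite (le_trans (ler_normD _ _))// lerD.
    rewrite lerD//; last by rewrite sumr_const card_ord mulr_natl.
    by rewrite (le_trans (ell1_psum_le _ _))// ue// leq_addr.
  move=> d d0; have k1 : 0 < k.+1%:R :> R by [].
  have [N HN] := ve (d / k.+1%:R) (divr_gt0 d0 k1).
  exists N => m Nm; have := HN (n + m)%N (leq_trans Nm (leq_addl _ _)).
  rewrite ltr_pdivlMr// mulrC; apply: le_lt_trans.
  have en0 : 0 <= e (n + m)%N by rewrite (le_trans _ (ue _ _ (leqnn _))).
  by rewrite ler_wpM2r// ler_nat.
have [v vE] : exists v : ell1 R, v =1 (fun i => l i - u 0%N i).
  by apply: (@ell1_ex _ (e 0%N)).
exists (v + u 0%N) => n; apply: ell1_norm_le => k.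
apply: le_trans (Hpsum n k); rewrite le_eqVlt; apply/orP; left; apply/eqP.
by apply: eq_bigr => i _; rewrite ell1D ell1N ell1D vE subrK.
Qed.

(** The pairing of ell1 with bounded sequences. *)
Definition ell1_sum u w : R := limn (fun n => \sum_(i < n) u i * w i).

Section ell1_sum.
Variables (u : ell1 R) (w : nat -> R) (M : R).
Hypothesis wM : forall i, `|w i| <= M.

Lemma ell1_sum_tail n :
  `|ell1_sum u w - \sum_(i < n) u i * w i| <= M * (`|u| - psum u n).
Proof.
have M0 : 0 <= M by exact: le_trans (wM 0%N).
pose s n := \sum_(i < n) u i * w i.
have diff k m : (k <= m)%N -> `|s m - s k| <= M * (psum u m - psum u k).
  move=> /subnKC <-; rewrite /s /psum !big_split_ord/= ![_ + _ - _]addrAC !subrr !add0r.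
  rewrite (le_trans (ler_norm_sum _ _ _))// mulr_sumr.
  by apply: ler_sum => i _; rewrite normrM mulrC ler_wpM2r.
have [l Hl] : exists l, forall n, `|l - s n| <= M * (`|u| - psum u n).
  apply: real_limit => k m km; rewrite (le_trans (diff _ _ km))// ler_wpM2l// lerB//.
  exact: ell1_psum_le.
suff -> : ell1_sum u w = l by exact: Hl.
apply/cvg_lim => //; apply: (vanishing_cvg Hl) => d d0.
have M1 : 0 < M + 1 by rewrite ltr_wpDl.
have [N HN] := ell1_tail u (divr_gt0 d0 M1).
exists N => k /HN; rewrite ltr_pdivlMr// => /(le_lt_trans _); apply.
by rewrite mulrC ler_wpM2l ?subr_ge0 ?ell1_psum_le// lerDl.
Qed.

Lemma ell1_sum_cvg : (fun n => \sum_(i < n) u i * w i) @ \oo --> ell1_sum u w.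
Proof.
have M0 : 0 <= M by exact: le_trans (wM 0%N).
apply: (vanishing_cvg ell1_sum_tail) => d d0.
have M1 : 0 < M + 1 by rewrite ltr_wpDl.
have [N HN] := ell1_tail u (divr_gt0 d0 M1).
exists N => k /HN; rewrite ltr_pdivlMr// => /(le_lt_trans _); apply.
by rewrite mulrC ler_wpM2l ?subr_ge0 ?ell1_psum_le// lerDl.
Qed.

Lemma ell1_sum_le : `|ell1_sum u w| <= M * `|u|.
Proof.
have := ell1_sum_tail 0; rewrite big_ord0 subr0.
by rewrite /psum big_ord0 subr0.
Qed.

End ell1_sum.

Lemma ell1_sum_linl a u v w (M : R) : (forall i, `|w i| <= M) ->
  ell1_sum (a *: u + v) w = a * ell1_sum u w + ell1_sum v w.
Proof.
move=> wM; apply/cvg_lim => //.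
rewrite (_ : (fun n => _) = (fun n => a * (\sum_(i < n) u i * w i)
                                  + \sum_(i < n) v i * w i)).
  by apply: cvgD; [apply: cvgM; [exact: cvg_cst|]|]; exact: ell1_sum_cvg wM.
apply/funext => n; rewrite mulr_sumr -big_split/=; apply: eq_bigr => i _.
by transitivity ((a * u i + v i) * w i) => //; ring.
Qed.

Lemma ell1_sum_linr a u w w' (M M' : R) : (forall i, `|w i| <= M) ->
  (forall i, `|w' i| <= M') ->
  ell1_sum u (fun i => a * w i + w' i) = a * ell1_sum u w + ell1_sum u w'.
Proof.
move=> wM wM'; apply/cvg_lim => //.
rewrite (_ : (fun n => _) = (fun n => a * (\sum_(i < n) u i * w i)
                                  + \sum_(i < n) u i * w' i)).
  apply: cvgD; first (apply: cvgM; first exact: cvg_cst).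
    exact: ell1_sum_cvg wM.
  exact: ell1_sum_cvg wM'.
apply/funext => n; rewrite mulr_sumr -big_split/=; apply: eq_bigr => i _.
by rewrite mulrDr mulrCA.
Qed.

End ell1_theory.

(** * The space C(2^N) *)
Section ccantor_theory.
Variable R : realType.
Implicit Types (v : ccantor R) (c : cantor_space).

Definition cagree n c c' := forall i, (i < n)%N -> c i = c' i.

Lemma nbhs_cagree n c : \forall c' \near c, cagree n c c'.
Proof.
have FF : Filter (nbhs c) by exact: nbhs_filter.
elim: n => [|n IH]; first by apply: (@filterE _ _ FF) => c' i.
have Hn : \forall c' \near c, c n = c' n.
  exact: (@proj_continuous nat (fun _ => bool) n c [set b | c n = b]).
apply: filterS2 Hn IH => c' cn cn' i; rewrite ltnS leq_eqVlt => /orP[/eqP->//|].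
exact: cn'.
Qed.

Lemma cagree_continuous n (f : cantor_space -> R) :
  (forall c c', cagree n c c' -> f c = f c') -> continuous f.
Proof.
move=> fn c; have FF : Filter (nbhs c) by exact: nbhs_filter.
apply/cvgrPdist_le => e e0; apply: filterS (nbhs_cagree n c) => c' cc'.
by rewrite (fn c c')// subrr normr0 ltW.
Qed.

Definition ccantor_mk (f : cantor_space -> R) (cf : continuous f) : ccantor R :=
  mkcts cf.

Lemma ccantor_near v c (e : R) : 0 < e ->
  \forall d \near c, `|ccantor_fun v c - ccantor_fun v d| < e.
Proof.
have FF : Filter (nbhs c) by exact: nbhs_filter.
have /cvgrPdist_lt : ccantor_fun v @ c --> ccantor_fun v c by exact: cts_fun.
exact.
Qed.

(** By compactness of the square: near a diagonal point continuity gives the bound,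
    and near a point off the diagonal the two arguments differ in a fixed
    coordinate, so that they do not agree on long initial segments. *)
Lemma ccantor_uniform v (e : R) : 0 < e ->
  exists n, forall c c', cagree n c c' -> `|ccantor_fun v c - ccantor_fun v c'| < e.
Proof.
move=> e0.
have /compact_near_coveringP cover :=
  compact_setX cantor_space_compact cantor_space_compact.
have := cover nat \oo (fun n p => cagree n p.1 p.2 ->
  `|ccantor_fun v p.1 - ccantor_fun v p.2| < e) _.
case.
  move=> [c c'] _.
  have [<-|ncc'] := pselect (c = c').
    have e2 : 0 < e / 2 by rewrite divr_gt0.
    have cv := ccantor_near v c e2.
    exists ([set p | `|ccantor_fun v c - ccantor_fun v p.1| < e / 2 /\
       `|ccantor_fun v c - ccantor_fun v p.2| < e / 2], setT) => /=.
      split; last exact: filterT.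
      by exists ([set d | `|ccantor_fun v c - ccantor_fun v d| < e / 2],
        [set d | `|ccantor_fun v c - ccantor_fun v d| < e / 2]).
    move=> [[d d'] n] /= [[h h'] _] _.
    move: h h'; rewrite !ltr_norml; lra.
  have [i ni] : exists i, c i <> c' i.
    apply: contrapT => H; apply: ncc'; apply/funext => i.
    by apply: contrapT => ?; apply: H; exists i.
  exists ([set p | c i = p.1 i /\ c' i = p.2 i], [set n | (i < n)%N]) => /=.
    split; last by exists i.+1.
    exists ([set d | c i = d i], [set d | c' i = d i]) => //=; split.
      exact: (@proj_continuous nat (fun _ => bool) i c [set b | c i = b]).
    exact: (@proj_continuous nat (fun _ => bool) i c' [set b | c' i = b]).
  move=> [[d d'] n] /= [[h h'] ni'] /(_ i ni') dd'; exfalso; apply: ni.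
  by rewrite h h'.
move=> n _ Hn; exists n => c c' cc'.
by apply: (Hn n (leqnn n) (c, c')).
Qed.

Lemma ccantor_norm_le v (M : R) : (forall c, `|ccantor_fun v c| <= M) -> `|v| <= M.
Proof. exact: sup_norm_le. Qed.

Lemma ccantor_norm_ge v c : `|ccantor_fun v c| <= `|v|.
Proof. exact: le_sup_norm. Qed.

Lemma ccantorB v w c : ccantor_fun (v - w) c = ccantor_fun v c - ccantor_fun w c.
Proof. by []. Qed.

Lemma ccantor_sum n (a : nat -> R) (y : nat -> ccantor R) c :
  ccantor_fun (\sum_(i < n) a i *: y i) c = \sum_(i < n) a i * ccantor_fun (y i) c.
Proof.
by elim/big_rec2: _ => //= i r v _ <-.
Qed.

Lemma ccantor_complete (v : nat -> ccantor R) e :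
  (forall n m, (n <= m)%N -> `|v m - v n| <= e n) -> vanishing e ->
  exists l, forall n, `|l - v n| <= e n.
Proof.
move=> ve e0.
have /choice[l Hl] c : exists l, forall n, `|l - ccantor_fun (v n) c| <= e n.
  apply: real_limit => n m /ve; apply: le_trans; exact: (ccantor_norm_ge (v m - v n)).
have cl : continuous (l : cantor_space -> R).
  move=> c; apply/cvgrPdist_le => d d0.
  have d3 : 0 < d / 3 by rewrite divr_gt0.
  have [N /(_ N (leqnn N)) eN] := e0 _ d3.
  have FF : Filter (nbhs c) by exact: nbhs_filter.
  apply: filterS (ccantor_near (v N) c d3) => c'; have := Hl c N; have := Hl c' N.
  rewrite !ler_norml ltr_norml; lra.
exists (ccantor_mk cl) => n; apply: ccantor_norm_le => c; exact: Hl.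
Qed.

(** Functions of the first [n] coordinates, with rational values: the value on a
    cylinder is looked up in [q] at the number of the cylinder. *)
Definition step_fun n (q : seq rat) (c : cantor_space) : R :=
  ratr (nth 0 q (pickle (mkseq c n))).

Lemma step_fun_continuous n q : continuous (step_fun n q).
Proof.
apply: (@cagree_continuous n) => c c' cc'; rewrite /step_fun.
suff -> : mkseq c n = mkseq c' n by [].
by apply/eq_in_map => i; rewrite mem_iota => /cc'.
Qed.

Definition step n q : ccantor R := ccantor_mk (@step_fun_continuous n q).

Lemma stepE n q c : ccantor_fun (step n q) c = step_fun n q c.
Proof. by []. Qed.

Lemma rat_approx (x e : R) : 0 < e -> exists q : rat, `|x - ratr q| < e.
Proof.
move=> e0; have [|q] := @rat_in_itvoo R x (x + e); first by rewrite ltrDl.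
rewrite in_itv/= => /andP[xq qx]; exists q.
by rewrite distrC ger0_norm ?subr_ge0 ?ltW// ltrBlDl.
Qed.

Lemma ccantor_separable : exists d : nat -> ccantor R,
  forall v (e : R), 0 < e -> exists k, `|v - d k| < e.
Proof.
exists (fun k => if unpickle k is Some (n, q) then step n q else 0) => v e e0.
have e2 : 0 < e / 3 by rewrite divr_gt0.
have [n Hn] := ccantor_uniform v e2.
pose pt (k : nat) : cantor_space :=
  if unpickle k is Some s then nth false s else fun=> false.
have /choice[q Hq] k : exists q : rat, `|ccantor_fun v (pt k) - ratr q| < e / 3.
  exact: rat_approx.
pose N := (\max_(s : n.-tuple bool) pickle (val s)).+1.
exists (pickle (n, mkseq q N)); rewrite pickleK.
apply: (@le_lt_trans _ _ (2 * (e / 3))); last by lra.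
apply: ccantor_norm_le => c.
have ltN : (pickle (mkseq c n) < N)%N.
  have sz : size (mkseq c n) == n by rewrite size_mkseq.
  by rewrite ltnS (leq_bigmax (Tuple sz)).
have -> : ccantor_fun (v - step n (mkseq q N)) c
    = ccantor_fun v c - ratr (q (pickle (mkseq c n))).
  by rewrite ccantorB stepE /step_fun nth_mkseq.
have := Hq (pickle (mkseq c n)).
have : `|ccantor_fun v c - ccantor_fun v (pt (pickle (mkseq c n)))| < e / 3.
  by apply: Hn => i ni; rewrite /pt pickleK /= nth_mkseq.
rewrite !ltr_norml ler_norml; lra.
Qed.

End ccantor_theory.

(** * Closed spans *)
Section cspan.
Variables (R : realType) (V : normedModType R).
Implicit Types (y : nat -> V) (a : nat -> R).

Lemma closed_normP (A : set V) :
  (forall v, (forall e : R, 0 < e -> exists2 w, A w & `|v - w| < e) -> A v) ->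
  closed A.
Proof.
move=> HA v clv; apply: HA => e e0.
have [w [Aw vw]] := clv _ (nbhsx_ballx v e e0).
by exists w => //; move: vw; rewrite -ball_normE.
Qed.

Lemma open_normP (U : set V) v : open U -> U v ->
  exists2 e : R, 0 < e & forall w, `|v - w| < e -> U w.
Proof.
move=> oU Uv; have /nbhs_ballP[e e0 eU] := open_nbhs_nbhs (conj oU Uv).
by exists e => // w vw; apply: eU; rewrite -ball_normE.
Qed.

Definition lincomb y a n := \sum_(i < n) a i *: y i.

Lemma lincomb_mono y a n m : (n <= m)%N ->
  lincomb y a n = lincomb y (fun i => if (i < n)%N then a i else 0) m.
Proof.
move=> /subnKC <-; rewrite /lincomb big_split_ord/= [X in _ = _ + X]big1 ?addr0.
  by apply: eq_bigr => i _; rewrite ltn_ord.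
by move=> i _; rewrite ltnNge leq_addr scale0r.
Qed.

Definition cspan_set y : set V := [set v | forall e : R, 0 < e ->
  exists a n, `|v - lincomb y a n| < e].

Lemma cspan_submod_closed y : submod_closed (mem (cspan_set y)).
Proof.
split.
  rewrite inE => e e0; exists (fun=> 0), 0%N.
  by rewrite /lincomb big_ord0 subr0 normr0.
move=> b u v; rewrite !inE => Hu Hv e e0.
have b1 : 0 < `|b| + 1 by rewrite ltr_wpDl.
have [a [n Ha]] := Hu (e / 2 / (`|b| + 1)) (divr_gt0 (divr_gt0 e0 (ltr0Sn _ 1)) b1).
have [a' [n' Ha']] := Hv (e / 2) (divr_gt0 e0 (ltr0Sn _ 1)).
rewrite (lincomb_mono _ _ (leq_maxl n n')) in Ha.
rewrite (lincomb_mono _ _ (leq_maxr n n')) in Ha'.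
set m := maxn n n' in Ha Ha'.
set w := lincomb _ _ _ in Ha; set w' := lincomb _ _ _ in Ha'.
exists (fun i => b * (if (i < n)%N then a i else 0) +
                 (if (i < n')%N then a' i else 0)), m.
have -> : lincomb y (fun i => b * (if (i < n)%N then a i else 0) +
                 (if (i < n')%N then a' i else 0)) m = b *: w + w'.
  rewrite /w /w' /lincomb scaler_sumr -big_split/=; apply: eq_bigr => i _.
  by rewrite scalerDl scalerA.
have -> : b *: u + v - (b *: w + w') = b *: (u - w) + (v - w').
  by rewrite scalerBr opprD addrACA.
rewrite (le_lt_trans (ler_normD _ _))// (splitr e) ler_ltD// normrZ.
move: Ha; rewrite ltr_pdivlMr// => /ltW; apply: le_trans.
by rewrite mulrC ler_wpM2l// lerDl.
Qed.

Lemma cspan_closed y : closed (cspan_set y).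
Proof.
apply: closed_normP => v Hv e e0; have e2 : 0 < e / 2 by rewrite divr_gt0.
have [w /(_ _ e2)[a [n Ha]] vw] := Hv _ e2; exists a, n.
rewrite -(subrK w v) -addrA (le_lt_trans (ler_normD _ _))// (splitr e).
exact: ltrD.
Qed.

Definition cspan y := ClosedSubspace (cspan_submod_closed y) (@cspan_closed y).

Lemma lincomb_cspan y a n : csub_set (cspan y) (lincomb y a n).
Proof. by move=> e e0; exists a, n; rewrite subrr normr0. Qed.

Lemma cspan_gen y i : csub_set (cspan y) (y i).
Proof.
suff -> : y i = lincomb y (fun j => (j == i)%:R) i.+1 by exact: lincomb_cspan.
rewrite /lincomb big_ord_recr/= eqxx scale1r big1 ?add0r// => j _.
by rewrite (ltn_eqF (ltn_ord j)) scale0r.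
Qed.

Lemma closed_subspace_ext (X Y : closed_subspace V) :
  (forall v, csub_set X v <-> csub_set Y v) -> X = Y.
Proof.
case: X Y => [X sX cX] [Y sY cY] /= XY.
have E : X = Y by apply/seteqP; split=> v /XY.
by case: _ / E sY cY => sY cY; congr ClosedSubspace; exact: Prop_irrelevance.
Qed.

(** Rational combinations form a countable family that is dense in the span. *)
Definition ratcomb y (q : seq rat) := lincomb y (fun i => ratr q`_i) (size q).

Lemma cspan_meets y (U : set V) : open U ->
  (csub_set (cspan y) `&` U !=set0) <-> exists q, U (ratcomb y q).
Proof.
move=> oU; split=> [[v [Yv Uv]]|[q Uq]]; last first.
  by exists (ratcomb y q); split=> //; exact: lincomb_cspan.
have [e e0 eU] := open_normP oU Uv.
have e2 : 0 < e / 2 by rewrite divr_gt0.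
have [a [n Ha]] := Yv _ e2.
pose S := \sum_(i < n) `|y i|.
have S0 : 0 < S + 1 by rewrite ltr_wpDl// sumr_ge0.
have /choice[q Hq] i : exists q : rat, `|a i - ratr q| < e / 2 / (S + 1).
  by apply: rat_approx; rewrite divr_gt0.
exists (mkseq q n); apply: eU.
have -> : ratcomb y (mkseq q n) = \sum_(i < n) ratr (q i) *: y i.
  by rewrite /ratcomb /lincomb size_mkseq; apply: eq_bigr => i _; rewrite nth_mkseq.
rewrite -(subrK (lincomb y a n) v) -addrA (le_lt_trans (ler_normD _ _))// (splitr e).
rewrite ltr_leD// /lincomb -sumrB (le_trans (ler_norm_sum _ _ _))//.
apply: (@le_trans _ _ (e / 2 / (S + 1) * S)); last first.
  by rewrite mulrAC ler_pdivrMr// ler_wpM2l ?(ltW e2)// lerDl.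
rewrite mulr_sumr; apply: ler_sum => i _.
by rewrite -scalerBl normrZ ler_wpM2r// ltW.
Qed.

End cspan.

Section subspace_sum.
Variables (R : realType) (V : normedModType R) (X : closed_subspace V).

Lemma csubP (v : V) : csub_set X v -> exists x : csub_type X, csub_val x = v.
Proof.
by move=> Xv; have Pv : v \in csub_pred X by [rewrite inE]; exists (CsubType Pv).
Qed.

Lemma closed_subspace_approx (v : V) :
  (forall e : R, 0 < e -> exists2 w, csub_set X w & `|v - w| < e) -> csub_set X v.
Proof.
move=> Hv; apply: csub_closed => B /nbhs_ballP[e /= e0 eB].
have [w Xw vw] := Hv e e0; exists w; split=> //.
by apply: eB; rewrite -ball_normE.
Qed.

Lemma csub_mem (x : csub_type X) : csub_set X (csub_val x).
Proof. by have := csub_valP x; rewrite inE. Qed.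

Lemma csub_lincomb (x : nat -> csub_type X) a n :
  csub_val (lincomb x a n) = lincomb (fun i => csub_val (x i)) a n.
Proof. by rewrite /lincomb; elim/big_rec2: _ => //= i r v _ <-. Qed.

End subspace_sum.

(** * Sequences equivalent to the unit vector basis of ell1 *)
Section ell1_basis.
Variable R : realType.

Definition ell1_basis (V : normedModType R) (c M : R) (y : nat -> V) :=
  (forall a n, c * psum a n <= `|lincomb y a n|) /\ (forall i, `|y i| <= M).

Lemma ell1_finite (a : nat -> R) k : exists u : ell1 R,
  u =1 (fun i => if (i < k)%N then a i else 0) /\ `|u| <= psum a k.
Proof.
have Hb n : psum (fun i => if (i < k)%N then a i else 0) n <= psum a k.
  apply: (@le_trans _ _ (psum (fun i => if (i < k)%N then a i else 0) (maxn k n))).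
    by apply: psum_le; exact: leq_maxr.
  rewrite /psum -(subnKC (leq_maxl k n)) big_split_ord/= [X in _ + X]big1 ?addr0.
    by apply: ler_sum => i _; rewrite ltn_ord.
  by move=> i _; rewrite ltnNge leq_addr normr0.
have [u uE] := ell1_ex Hb; exists u; split=> //; apply: ell1_norm_le => n.
by apply: le_trans (Hb n); apply: ler_sum => i _; rewrite uE.
Qed.

Lemma lincomb_le (V : normedModType R) (y : nat -> V) (M : R) a n :
  (forall i, `|y i| <= M) -> `|lincomb y a n| <= M * psum a n.
Proof.
move=> yM; rewrite (le_trans (ler_norm_sum _ _ _))// mulr_sumr.
by apply: ler_sum => i _; rewrite normrZ mulrC ler_wpM2r.
Qed.

Section synthesis.
Variables (c M : R) (y : nat -> ccantor R).
Hypotheses (c0 : 0 < c) (yb : ell1_basis c M y).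

Let yM i : `|y i| <= M. Proof. exact: yb.2. Qed.
Let M0 : 0 <= M. Proof. exact: le_trans (yM 0%N). Qed.

Let yxM x i : `|ccantor_fun (y i) x| <= M.
Proof. exact: le_trans (ccantor_norm_ge _ _) (yM i). Qed.

Let tail (u : ell1 R) n := `|u| - psum u n.

Let tail_ge0 u n : 0 <= tail u n.
Proof. by rewrite subr_ge0 ell1_psum_le. Qed.

Let vtail u k : 0 <= k -> vanishing (fun n => k * tail u n).
Proof. by move=> k0; apply: vanishingZ => //; exact: ell1_tail. Qed.

Lemma ell1_synthesis (u : ell1 R) :
  exists v : ccantor R, forall n, `|v - lincomb y u n| <= M * tail u n.
Proof.
apply: ccantor_complete; last exact: vtail.
move=> n m nm; apply: ccantor_norm_le => x.
rewrite ccantorB !ccantor_sum.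
move: nm => /subnKC <-; rewrite !big_split_ord/= addrAC subrr add0r.
rewrite (le_trans (ler_norm_sum _ _ _))//.
apply: (@le_trans _ _ (\sum_(i < m - n) M * `|u (n + i)%N|)).
  by apply: ler_sum => i _; rewrite normrM mulrC ler_wpM2r.
rewrite -mulr_sumr ler_wpM2l// lerBrDl (le_trans _ (ell1_psum_le u (n + (m - n))))//.
by rewrite /psum big_split_ord.
Qed.

(** The sum of the [u i *: y i], the synthesis operator of the sequence [y]. *)
Definition synth u := sval (cid (ell1_synthesis u)).

Lemma synthP u n : `|synth u - lincomb y u n| <= M * tail u n.
Proof. by rewrite /synth; case: cid. Qed.

Lemma synthE u x : ccantor_fun (synth u) x = ell1_sum u (fun i => ccantor_fun (y i) x).
Proof.
have H : (fun n => \sum_(i < n) u i * ccantor_fun (y i) x) @ \oo --> ccantor_fun (synth u) x.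
  apply: (@vanishing_cvg _ _ (fun n => M * tail u n)); last exact: vtail.
  move=> n; rewrite -ccantor_sum -ccantorB.
  exact: le_trans (ccantor_norm_ge _ _) (synthP u n).
by apply/esym/cvg_lim.
Qed.

Lemma synth_linear : linear synth.
Proof.
move=> a u v; apply: val_inj; apply/funext => x.
transitivity (a * ccantor_fun (synth u) x + ccantor_fun (synth v) x) => //.
by rewrite -[LHS]/(ccantor_fun _ x) !synthE; exact: ell1_sum_linl (yxM x).
Qed.

Lemma synth_le u : `|synth u| <= M * `|u|.
Proof.
have := synthP u 0.
by rewrite /tail /psum /lincomb !big_ord0 !subr0.
Qed.

Lemma synth_ge u : c * `|u| <= `|synth u|.
Proof.
rewrite -subr_le0.
apply: (@vanishing_eq0 _ _ (fun n => (c + M) * tail u n)); last first.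
  by apply: vtail; rewrite addr_ge0// ltW.
move=> n; have := yb.1 u n; have := synthP u n.
have : `|lincomb y u n| <= `|synth u| + `|synth u - lincomb y u n|.
  by rewrite -{1}(subrK (synth u) (lincomb y u n)) (le_trans (ler_normD _ _))// addrC distrC.
rewrite mulrDl {2}/tail mulrBr; lra.
Qed.

Lemma synth_cspan u : csub_set (cspan y) (synth u).
Proof.
move=> e e0; have [n /(_ n (leqnn _)) Hn] := vtail u M0 e0.
by exists u, n; exact: le_lt_trans (synthP u n) Hn.
Qed.

Lemma synthB u v : synth (u - v) = synth u - synth v.
Proof. by rewrite addrC -scaleN1r synth_linear scaleN1r addrC. Qed.

(** The combinations that approximate a point of the span have coefficients that
    are Cauchy in ell1, because synthesis is bounded below. *)
Lemma synth_surj v : csub_set (cspan y) v -> exists u, synth u = v.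
Proof.
move=> yv; pose h n : R := n.+1%:R^-1.
have h0 n : 0 < h n by rewrite invr_gt0.
have /choice[A HA] n : exists u : ell1 R, `|v - synth u| <= c / 2 * h n.
  have c2 : 0 < c / 2 * h n by rewrite mulr_gt0// divr_gt0.
  have [a [k Hk]] := yv _ c2.
  have [u [uE unorm]] := ell1_finite a k; exists u.
  suff -> : synth u = lincomb y a k by exact: ltW.
  have E : lincomb y u k = lincomb y a k.
    by apply: eq_bigr => i _; rewrite uE ltn_ord.
  apply/eqP; rewrite -subr_eq0 -E -normr_le0 (le_trans (synthP u k))//.
  rewrite mulr_ge0_le0// subr_le0 (le_trans unorm)//.
  by apply: ler_sum => i _; rewrite uE ltn_ord.
have [|L HL] := ell1_complete (u := A) (e := h) _ (@vanishing_harmonic R).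
  move=> n m nm; rewrite -(ler_pM2l c0) (le_trans (synth_ge _))// synthB.
  have -> : synth (A m) - synth (A n) = (v - synth (A n)) - (v - synth (A m)).
    by rewrite opprB [RHS]addrC addrA subrK.
  rewrite (le_trans (ler_normB _ _))// (le_trans (lerD (HA n) (HA m)))//.
  have : h m <= h n by rewrite /h lef_pV2 ?posrE// ler_nat.
  rewrite -(ler_pM2l c0); lra.
exists L; apply/eqP; rewrite -subr_eq0 -normr_le0.
apply: (@vanishing_eq0 _ _ (fun n => (M + c) * h n)); last first.
  apply: vanishingZ; [by move=> n; exact: ltW|by rewrite addr_ge0// ltW|].
  exact: vanishing_harmonic.
move=> n; have -> : synth L - v = synth (L - A n) - (v - synth (A n)).
  by rewrite synthB opprB addrA subrK.
rewrite (le_trans (ler_normB _ _))// mulrDl lerD//.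
  by rewrite (le_trans (synth_le _))// ler_wpM2l.
by rewrite (le_trans (HA n))// ler_wpM2r ?ltW// ltr_pdivrMr// ltr_pMr// ltr1n.
Qed.

Theorem ell1_basis_isomorphic : isomorphic (csub_type (cspan y)) (ell1 R).
Proof.
apply: isomorphic_sym.
have /choice[F HF] u : exists x : csub_type (cspan y), csub_val x = synth u.
  by apply: csubP; exact: synth_cspan.
have /choice[G HG] (x : csub_type (cspan y)) : exists u, synth u = csub_val x.
  by apply: synth_surj; exact: csub_mem.
have FL : linear F.
  by move=> a u v; apply: val_inj => /=; rewrite HF synth_linear -!HF.
pose f : {linear ell1 R -> csub_type (cspan y)} :=
  HB.pack F (GRing.isLinear.Build _ _ _ _ F FL).
have inj u v : synth u = synth v -> u = v.
  move=> uv; apply/eqP; rewrite -subr_eq0 -normr_le0 -(ler_pM2l c0) mulr0.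
  by rewrite (le_trans (synth_ge _))// synthB uv subrr normr0.
apply: (@isomorphic_bounded R _ _ f G M c^-1).
- by move=> u; apply: inj; rewrite HG HF.
- by move=> x; apply: val_inj => /=; rewrite HF HG.
- by move=> u; have := synth_le u; rewrite -HF.
- by move=> x; rewrite ler_pdivlMl//; have := synth_ge (G x); rewrite HG.
Qed.

End synthesis.

Lemma ell1_unit : exists e : nat -> ell1 R, [/\ forall i, `|e i| <= 1,
  forall a n, psum a n <= `|lincomb e a n| &
  forall (u : ell1 R) n, `|u - lincomb e u n| <= `|u| - psum u n].
Proof.
pose dl (i j : nat) : R := (j == i)%:R.
have /choice[e He] i : exists u : ell1 R, u =1 dl i /\ `|u| <= 1.
  have [u [uE un]] := ell1_finite (dl i) i.+1.
  exists u; split.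
    move=> j; rewrite uE ltnS /dl; have [->|ji] := eqVneq j i; first by rewrite leqnn.
    by case: ifP.
  rewrite (le_trans un)// /psum big_ord_recr/= /dl eqxx normr1 big1 ?add0r// => j _.
  by rewrite (ltn_eqF (ltn_ord j)) normr0.
have eE i j : e i j = (j == i)%:R by have [-> _] := He i.
have lcE a n j : lincomb e a n j = if (j < n)%N then a j else 0.
  rewrite /lincomb; elim: n => [|n IH]; first by rewrite big_ord0.
  rewrite big_ord_recr/=; transitivity (ell1_seq (lincomb e a n) j + a n * e n j) => //.
  rewrite IH eE ltnS; case: ltngtP => jn.
  - by rewrite mulr0 addr0.
  - by rewrite mulr0 addr0.
  - by rewrite jn mulr1 add0r.
exists e; split=> [i|a n|u n]; first exact: (He i).2.
  apply: le_trans (ell1_psum_le _ n); apply: ler_sum => i _.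
  by rewrite lcE ltn_ord.
apply: ell1_norm_le => k; rewrite lerBrDr.
apply: (@le_trans _ _ (psum u (maxn k n))); last exact: ell1_psum_le.
have -> : psum u n = psum (lincomb e u n) (maxn k n).
  rewrite /psum -(subnKC (leq_maxr k n)) big_split_ord/= [X in _ = _ + X]big1 ?addr0.
    by apply: eq_bigr => i _; rewrite lcE ltn_ord.
  by move=> i _; rewrite lcE ltnNge leq_addr normr0.
apply: le_trans (_ : _ <= psum (u - lincomb e u n) (maxn k n) +
   psum (lincomb e u n) (maxn k n)) _.
  by rewrite lerD2r psum_le// leq_maxl.
rewrite /psum -big_split/=; apply: ler_sum => i _.
apply: (@le_trans _ _ (`|u i - lincomb e u n i| + `|lincomb e u n i|)).
  exact: lexx.
by rewrite lcE; case: ifP => _; rewrite ?subrr ?subr0 normr0 ?addr0 ?add0r.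
Qed.

(** The basis is the image of the unit vectors of ell1. *)
Lemma isomorphic_ell1_basis (Y : closed_subspace (ccantor R)) :
  isomorphic (csub_type Y) (ell1 R) ->
  exists c M y, [/\ 0 < c, ell1_basis c M y & Y = cspan y].
Proof.
move=> /isomorphicP[f [g [M [fK gK M0 fM gM]]]].
have [e [e1 psE etail]] := ell1_unit.
have lin a n : g (lincomb e a n) = lincomb (fun i => g (e i)) a n.
  by rewrite /lincomb raddf_sum; apply: eq_bigr => i _; exact: linearZ.
exists M^-1, M, (fun i => csub_val (g (e i))); split; first by rewrite invr_gt0.
  split=> [a n|i]; last first.
    by rewrite (le_trans (gM (e i)))// ler_piMr ?e1// ltW.
  rewrite -csub_lincomb -lin ler_pdivrMl// (le_trans (psE a n))//.
  by have := fM (g (lincomb e a n)); rewrite gK.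
apply: closed_subspace_ext => v; split=> [Yv|].
  have [x xv] := csubP Yv; move=> d d0.
  have dM : 0 < d / M by rewrite divr_gt0.
  have [n /(_ n (leqnn n)) Hn] := ell1_tail (f x) dM.
  exists (f x), n; rewrite -csub_lincomb -lin -xv.
  have -> : csub_val x - csub_val (g (lincomb e (f x) n)) =
            csub_val (g (f x - lincomb e (f x) n)).
    by rewrite linearB/= fK.
  apply: (@le_lt_trans _ _ (M * (`|f x| - psum (f x) n))).
    by rewrite (le_trans (gM _))// ler_pM2l// etail.
  by rewrite mulrC -ltr_pdivlMr.
move=> Hv; apply: closed_subspace_approx => d d0.
have [a [n Hn]] := Hv d d0.
exists (lincomb (fun i => csub_val (g (e i))) a n) => //.
by rewrite -csub_lincomb; exact: csub_mem.
Qed.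

Lemma ell1_separable : exists D : nat -> ell1 R,
  forall u (d : R), 0 < d -> exists k, `|u - D k| < d.
Proof.
have [e [_ _ etail]] := ell1_unit.
exists (fun k => if unpickle k is Some q then ratcomb e q else 0) => u d d0.
have eu : csub_set (cspan e) u.
  move=> r r0; have [n /(_ n (leqnn n)) Hn] := ell1_tail u r0.
  by exists u, n; exact: le_lt_trans (etail u n) Hn.
have [q Hq] : exists q, ball u d (ratcomb e q).
  by apply/cspan_meets; [exact: ball_open|exists u; split=> //; exact: ballxx].
by exists (pickle q); rewrite pickleK; move: Hq; rewrite -ball_normE.
Qed.

(** Approximating the images of the points [d y] by elements of a countable dense
    subset of ell1 would embed the Baire space into the natural numbers. *)
Lemma separated_not_ell1 (V : normedModType R) (d : baire -> V) :
  (forall y y', y <> y' -> 1 <= `|d y - d y'|) -> ~ isomorphic V (ell1 R).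
Proof.
move=> dsep /isomorphicP[f [g [M [fK gK M0 fM gM]]]].
have [D HD] := ell1_separable.
have M2 : 0 < M^-1 / 2 by rewrite divr_gt0// invr_gt0.
have /choice[k Hk] y : exists k, `|f (d y) - D k| < M^-1 / 2 by exact: HD.
have kinj y y' : k y = k y' -> y = y'.
  move=> kk; apply: contrapT => /dsep; rewrite leNgt; apply/negP/negPn.
  have -> : d y - d y' = g (f (d y) - f (d y')) by rewrite linearB !fK.
  rewrite (le_lt_trans (gM _))// -ltr_pdivlMl// mulr1.
  have -> : f (d y) - f (d y') = (f (d y) - D (k y)) - (f (d y') - D (k y')).
    by rewrite kk opprB addrA subrK.
  rewrite (le_lt_trans (ler_normB _ _))// (splitr M^-1).
  exact: ltrD.
(* No map from the Baire space to nat is injective: Cantor's diagonal. *)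
pose diag n := if pselect (exists y, k y = n) is left H then (sval (cid H) n).+1 else 0%N.
have := erefl (diag (k diag)); rewrite {1}/diag.
case: pselect => [H|]; last by case; exists diag.
by case: cid => y /= /kinj -> /esym/n_Sn.
Qed.

End ell1_basis.

(** * Bounded functionals *)
Section dual_theory.
Variables (R : realType) (V : normedModType R).

Lemma dual_linear (F : dual V) : linear F.
Proof. by have := dual_funP F; rewrite inE => -[]. Qed.

Lemma dual0 (F : dual V) : F 0 = 0.
Proof.
have := dual_linear F 1 0 0; rewrite scaler0 addr0 scale1r => H.
by apply: (@addrI _ (F 0)); rewrite addr0 -H.
Qed.

Lemma dualZ (F : dual V) a v : F (a *: v) = a * F v.
Proof. by rewrite -[a *: v]addr0 dual_linear dual0 addr0. Qed.

Lemma dualD (F : dual V) u v : F (u + v) = F u + F v.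
Proof. by rewrite -[u]scale1r dual_linear !scale1r. Qed.

Lemma dualB (F : dual V) u v : F (u - v) = F u - F v.
Proof. by rewrite dualD -scaleN1r dualZ mulN1r. Qed.

Lemma dual_lincomb (F : dual V) y a n : F (lincomb y a n) = \sum_(i < n) a i * F (y i).
Proof.
rewrite /lincomb; elim: n => [|n IH]; first by rewrite !big_ord0 dual0.
by rewrite !big_ord_recr/= dualD dualZ IH.
Qed.

Lemma dual_le (F : dual V) v : `|F v| <= `|F| * `|v|.
Proof.
have [->|v0] := eqVneq v 0; first by rewrite dual0 !normr0 mulr0.
have nv : 0 < `|v| by rewrite normr_gt0.
have : `|F (`|v|^-1 *: v)| <= `|F|.
  by apply: le_dual_norm; rewrite normrZ normfV normr_id mulVf// gt_eqF.
by rewrite dualZ normrM normfV normr_id ler_pdivrMl// mulrC.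
Qed.

Lemma dual_norm_le1 (F : dual V) (M : R) : 0 <= M ->
  (forall v, `|F v| <= M * `|v|) -> `|F| <= M.
Proof.
move=> M0 FM; apply: dual_norm_le => v v1.
by rewrite (le_trans (FM v))// ler_piMr.
Qed.

Lemma dual_ex (f : V -> R) (M : R) : linear f -> (forall v, `|f v| <= M * `|v|) ->
  exists F : dual V, F =1 f.
Proof.
move=> lf fM.
pose g : {linear V -> R} := HB.pack f (GRing.isLinear.Build _ _ _ _ f lf).
have cf : continuous f.
  by apply: (linear_bound_continuous (f := g)) => u; exact: fM.
have fP : f \in dual_pred by rewrite inE.
by exists (Dual fP).
Qed.

Lemma dual_ext (F G : dual V) : F =1 G -> F = G.
Proof. by move=> FG; apply: val_inj; apply/funext. Qed.

End dual_theory.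

Lemma sum_at_most_one (R : realType) n (P : nat -> bool) :
  (forall i j, (i < j < n)%N -> P i -> P j -> False) ->
  \sum_(i < n) (P i)%:R <= 1 :> R.
Proof.
elim: n => [|n IH] HP; first by rewrite big_ord0.
rewrite big_ord_recr/=; have [Pn|nPn] := boolP (P n); last first.
  rewrite addr0; apply: IH => i j /andP[ij jn]; apply: HP.
  by rewrite ij ltnW.
rewrite big1 ?add0r// => i _.
case Pi : (P i) => //; exfalso; apply: (HP i n) => //.
by rewrite ltn_ord leqnn.
Qed.

Lemma ell1_sum_lincomb (R : realType) (b : ell1 R) (w : nat -> nat -> R)
    (a : nat -> R) N : (forall j k, `|w j k| <= 1) ->
  ell1_sum b (fun k => \sum_(j < N) a j * w j k) = \sum_(j < N) a j * ell1_sum b (w j).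
Proof.
move=> w1; elim: N => [|N IH].
  rewrite big_ord0; apply/eqP; rewrite -normr_le0.
  have := @ell1_sum_le _ b (fun k => \sum_(j < 0) a j * w j k) 0.
  by rewrite mul0r; apply => i; rewrite big_ord0 normr0.
rewrite big_ord_recr/= -IH addrC.
have wN k : `|\sum_(j < N) a j * w j k| <= psum a N.
  rewrite (le_trans (ler_norm_sum _ _ _))//; apply: ler_sum => j _.
  by rewrite normrM ler_piMr.
rewrite -(ell1_sum_linr (a N) b (w1 N) wN); congr (ell1_sum b _).
by apply/funext => k; rewrite big_ord_recr/= addrC.
Qed.

(** * The dual of the span of a nested family of indicator functions *)

(** Any two of the sets [W i] are nested or disjoint, a smaller set has a larger
    index, and [x i] is a point of [W i] that belongs to none of the smaller sets.
    So [W i (x j)] is the forest order: [i] is an ancestor of [j] or [j] itself. *)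
Section forest.
Variable R : realType.
Variables (W : nat -> cantor_space -> bool) (x : nat -> cantor_space).
Variable e : nat -> ccantor R.
Hypothesis eE : forall i c, ccantor_fun (e i) c = (W i c)%:R.
Hypothesis W_self : forall i, W i (x i).
Hypothesis W_nested : forall i j, W i (x j) -> (i <= j)%N /\ forall c, W j c -> W i c.
Hypothesis W_meet : forall i j c, (i <= j)%N -> W i c -> W j c -> W i (x j).

Let X := cspan e.
Let VX : normedModType R := csub_type X.

(** [j] is an immediate successor of [i] in the forest order. *)
Definition child i j := [&& (i < j)%N, W i (x j) &
  all (fun k => ~~ ((i < k)%N && W k (x j))) (iota 0 j)].

(** [c] lies in one of the sets with index less than [N] strictly below [W i]. *)
Definition below i N c := has (fun j => [&& (i < j)%N, W i (x j) & W j c]) (iota 0 N).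

Lemma child_unique i c j k : (j < k)%N -> child i j && W j c -> child i k && W k c ->
  False.
Proof.
move=> jk /andP[/and3P[ij _ _] Wj] /andP[/and3P[_ _ /allP/(_ j)] + Wk].
rewrite mem_iota jk ij/= => /(_ isT) /negP; apply.
by apply: (W_meet (ltnW jk)) Wj Wk.
Qed.

(** Among the sets strictly below [W i] that contain [c] and have index less than
    [N], the one of least index is a child of [i], and it is the only child that
    contains [c]. *)
Lemma sum_children i N c :
  \sum_(j < N) (child i j)%:R * (W j c)%:R = (below i N c)%:R :> R.
Proof.
have -> : \sum_(j < N) (child i j)%:R * (W j c)%:R =
    \sum_(j < N) (child i j && W j c)%:R :> R.
  by apply: eq_bigr => j _; case: (child i j); rewrite ?mul1r ?mul0r.
apply/eqP; rewrite eq_le; have [b|nb] := boolP (below i N c); last first.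
  suff E j : (j < N)%N -> child i j && W j c = false.
    by rewrite big1 ?lexx// => j _; rewrite E.
  move=> jN; apply: contraNF nb => /andP[/and3P[ij Wij _] Wjc].
  by apply/hasP; exists j; rewrite ?mem_iota// ij Wij.
apply/andP; split.
  apply: (@sum_at_most_one R N (fun j => child i j && W j c)) => j k /andP[jk _].
  exact: child_unique.
pose P j := [&& (j < N)%N, (i < j)%N, W i (x j) & W j c].
have exP : exists j, P j.
  by move/hasP : b => [j]; rewrite mem_iota => /andP[_ jN] H; exists j; rewrite /P jN.
case: (ex_minnP exP) => j /and4P[jN ij Wij Wjc] minj.
have cij : child i j.
  rewrite /child ij Wij/=; apply/allP => k; rewrite mem_iota => /andP[_ /= kj].
  apply/negP => /andP[ik Wkj].
  have Wkc : W k c by apply: (W_nested Wkj).2.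
  have Wik : W i (x k) by apply: (W_meet (ltnW ik)) Wkc; exact: (W_nested Wij).2.
  have : P k by rewrite /P (ltn_trans kj jN) ik Wik.
  by move/minj; rewrite leqNgt kj.
by rewrite (bigD1 (Ordinal jN))//= cij Wjc/= lerDl sumr_ge0.
Qed.

Lemma top_unique i j N c : (i < j < N)%N ->
  W i c && ~~ below i N c -> W j c && ~~ below j N c -> False.
Proof.
move=> /andP[ij jN] /andP[Wi /negP nb] /andP[Wj _]; apply: nb; apply/hasP.
by exists j; rewrite ?mem_iota// ij Wj (W_meet (ltnW ij) Wi Wj).
Qed.

Lemma below_W i N c : below i N c -> W i c.
Proof. by move=> /hasP[j _ /and3P[_ Wij Wjc]]; exact: (W_nested Wij).2. Qed.

Lemma forest_gen i : exists v : VX, csub_val v = e i.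
Proof. by apply: csubP; exact: cspan_gen. Qed.

Let E i : VX := sval (cid (forest_gen i)).

Let EE i : csub_val (E i) = e i. Proof. by rewrite /E; case: cid. Qed.

Let eval_lincomb a n c :
  ccantor_fun (csub_val (lincomb E a n)) c = \sum_(i < n) a i * (W i c)%:R.
Proof.
rewrite csub_lincomb ccantor_sum; apply: eq_bigr => i _.
by rewrite EE eE.
Qed.

Section functional.
Variable F : dual VX.

Lemma functional_le1 (v : VX) :
  (forall c, `|ccantor_fun (csub_val v) c| <= 1) -> `|F v| <= `|F|.
Proof. by move=> v1; apply: (@le_dual_norm _ _ F v); exact: ccantor_norm_le v1. Qed.

(** The children of a node have disjoint sets, so a signed sum of their indicator
    functions has norm at most 1. *)
Lemma children_summable i n : psum (fun j => (child i j)%:R * F (E j)) n <= `|F|.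
Proof.
have -> : psum (fun j => (child i j)%:R * F (E j)) n =
    F (lincomb E (fun j => (child i j)%:R * Num.sg (F (E j))) n).
  rewrite dual_lincomb; apply: eq_bigr => j _.
  by rewrite normrM (normrEsg (F _)) ger0_norm// mulrA.
apply: le_trans (ler_norm _) _; apply: functional_le1 => c.
rewrite eval_lincomb (le_trans (ler_norm_sum _ _ _))//.
apply: (@le_trans _ _ (\sum_(j < n) (child i j)%:R * (W j c)%:R)); last first.
  by rewrite sum_children; case: below.
apply: ler_sum => j _; rewrite !normrM !normr_nat ler_wpM2r// ler_piMr//.
by rewrite normr_sg; case: eqP.
Qed.

Definition child_seq i : ell1 R := sval (cid (ell1_ex (@children_summable i))).

Lemma child_seqE i j : child_seq i j = (child i j)%:R * F (E j).
Proof. by rewrite /child_seq; case: cid. Qed.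

(** If [F] is integration against a measure, this is the measure of [W i] with the
    sets of the children removed, which contains [x i] and no other [x j]. *)
Definition mass i := F (E i) - ell1_sum (child_seq i) (fun=> 1).

Lemma mass_cvg i :
  (fun N => F (E i) - \sum_(j < N) (child i j)%:R * F (E j)) @ \oo --> mass i.
Proof.
apply: cvgB; first exact: cvg_cst.
have -> : (fun N => \sum_(j < N) (child i j)%:R * F (E j)) =
   (fun N => \sum_(j < N) child_seq i j * 1).
  by apply/funext => N; apply: eq_bigr => j _; rewrite child_seqE mulr1.
by apply: (@ell1_sum_cvg _ _ _ 1) => j; rewrite normr1.
Qed.

(** Removing from [W i] its children of index less than [N] leaves sets that are
    disjoint for the indices below [N], so signed sums of their indicator functions
    have norm at most 1. *)
Lemma mass_approx_summable n N : (n <= N)%N ->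
  psum (fun i => F (E i) - \sum_(j < N) (child i j)%:R * F (E j)) n <= `|F|.
Proof.
move=> nN; pose t i := F (E i) - \sum_(j < N) (child i j)%:R * F (E j).
pose y i : VX := E i - lincomb E (fun j => (child i j)%:R) N.
have Fy i : F (y i) = t i by rewrite dualB dual_lincomb.
have -> : psum t n = F (lincomb y (fun i => Num.sg (t i)) n).
  by rewrite dual_lincomb; apply: eq_bigr => i _; rewrite Fy normrEsg.
apply: le_trans (ler_norm _) _; apply: functional_le1 => c.
have yE i : ccantor_fun (csub_val (y i)) c = (W i c && ~~ below i N c)%:R.
  rewrite -[LHS]/(ccantor_fun (csub_val (E i)) c -
    ccantor_fun (csub_val (lincomb E (fun j => (child i j)%:R) N)) c).
  rewrite eval_lincomb sum_children EE eE.
  have [/below_W->|_] := boolP (below i N c); first by rewrite subrr.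
  by rewrite subr0 andbT.
rewrite csub_lincomb ccantor_sum (le_trans (ler_norm_sum _ _ _))//.
apply: (@le_trans _ _ (\sum_(i < n) (W i c && ~~ below i N c)%:R)).
  apply: ler_sum => i _; rewrite yE normrM normr_nat ler_piMl//.
  by rewrite normr_sg; case: eqP.
apply: (@sum_at_most_one R n (fun i => W i c && ~~ below i N c)).
move=> i j /andP[ij jn]; apply: top_unique.
by rewrite ij (leq_trans jn).
Qed.

Lemma mass_summable n : psum mass n <= `|F|.
Proof.
pose t N i := F (E i) - \sum_(j < N) (child i j)%:R * F (E j).
have cvgt : (fun N => psum (t N) n) @ \oo --> psum mass n.
  rewrite /psum; elim: n => [|n IH].
    rewrite big_ord0 (_ : (fun _ => _) = (fun=> 0)); first exact: cvg_cst.
    by apply/funext => N; rewrite big_ord0.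
  rewrite big_ord_recr (_ : (fun _ => _) = (fun N => \sum_(i < n) `|t N i| + `|t N n|)).
    by apply: cvgD => //; apply: cvg_norm; exact: mass_cvg.
  by apply/funext => N; rewrite big_ord_recr.
rewrite -(cvg_lim _ cvgt)//; apply: limr_le; first by apply/cvg_ex; eexists; exact: cvgt.
by exists n => // N /= nN; exact: mass_approx_summable.
Qed.

End functional.

Definition masses F : ell1 R := sval (cid (ell1_ex (@mass_summable F))).

Lemma massesE F i : masses F i = mass F i.
Proof. by rewrite /masses; case: cid => u uE /=; rewrite uE. Qed.

Lemma masses_le F : `|masses F| <= `|F|.
Proof.
apply: ell1_norm_le => n; apply: le_trans (mass_summable F n).
by apply: ler_sum => i _; rewrite massesE.
Qed.

Lemma atomic_ex (b : ell1 R) : exists G : dual VX,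
  forall v, G v = ell1_sum b (fun k => ccantor_fun (csub_val v) (x k)).
Proof.
have bd (v : VX) k : `|ccantor_fun (csub_val v) (x k)| <= `|v|.
  exact: ccantor_norm_ge.
apply: (@dual_ex _ _ _ `|b|).
  by move=> a u v; exact: ell1_sum_linr (bd u) (bd v).
by move=> v; rewrite mulrC; apply: ell1_sum_le; exact: bd.
Qed.

(** The functional given by the masses [b k] at the points [x k]. *)
Definition atomic b : dual VX := sval (cid (atomic_ex b)).

Lemma atomicE b v : atomic b v = ell1_sum b (fun k => ccantor_fun (csub_val v) (x k)).
Proof. by rewrite /atomic; case: cid. Qed.

Lemma atomic_le b : `|atomic b| <= `|b|.
Proof.
apply: dual_norm_le1 => // v; rewrite atomicE mulrC; apply: ell1_sum_le => k.
exact: ccantor_norm_ge.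
Qed.

Lemma atomic_linear : linear atomic.
Proof.
move=> a b b'; apply: dual_ext => v.
transitivity (a * atomic b v + atomic b' v) => //.
rewrite !atomicE; apply: (@ell1_sum_linl _ _ _ _ _ `|v|) => k.
exact: ccantor_norm_ge.
Qed.

Let wt i k : R := (W i (x k))%:R.
Let wt' i k : R := ((i < k)%N && W i (x k))%:R.
Let wt1 i k : `|wt i k| <= 1. Proof. by rewrite normr_nat; case: W. Qed.
Let wt1' i k : `|wt' i k| <= 1. Proof. by rewrite normr_nat; case: (_ && _). Qed.

Lemma atomic_gen b i : atomic b (E i) = ell1_sum b (wt i).
Proof. by rewrite atomicE; congr ell1_sum; apply/funext => k; rewrite EE eE. Qed.

Lemma ell1_sum_self (b : ell1 R) i : ell1_sum b (wt i) = b i + ell1_sum b (wt' i).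
Proof.
pose dl (k : nat) : R := (k == i)%:R.
have dl1 k : `|dl k| <= 1 by rewrite normr_nat; case: (_ == _).
have -> : b i = ell1_sum b dl.
  apply/esym/cvg_lim => //; apply: cvg_near_cst; exists i.+1 => // n /= ltin.
  rewrite (bigD1 (Ordinal ltin))//= /dl eqxx mulr1 big1 ?addr0// => j ji.
  case: eqP => [jE|]; last by rewrite mulr0.
  by move: ji; rewrite -val_eqE/= jE eqxx.
rewrite -[ell1_sum b dl]mul1r -(ell1_sum_linr 1 b dl1 (wt1' i)).
congr ell1_sum; apply/funext => k; rewrite mul1r /wt /dl /wt'.
have [->|ki] := eqVneq k i; first by rewrite ltnn W_self addr0.
rewrite add0r; case: ltngtP ki => //= ki _.
case Wik : (W i (x k)) => //.
by have [] := W_nested Wik; rewrite leqNgt ki.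
Qed.

(** A node strictly below [i] is at or below exactly one child of [i].  With the
    children of index less than [N] only, the nodes that are missed have index at
    least [N], so the error is at most a tail of [b]. *)
Lemma children_sum_cvg (b : ell1 R) i :
  (fun N => \sum_(j < N) (child i j)%:R * ell1_sum b (wt j)) @ \oo
  --> ell1_sum b (wt' i).
Proof.
apply: (vanishing_cvg _ (@ell1_tail _ b)) => N.
rewrite -(ell1_sum_lincomb b (fun j => (child i j)%:R) N wt1).
pose w k := wt' i k - \sum_(j < N) (child i j)%:R * wt j k.
have wE k : w k = wt' i k - (below i N (x k))%:R by rewrite /w sum_children.
have w1 k : `|w k| <= 1.
  rewrite wE /wt'; case: (_ && _); case: below; rewrite ?subrr ?subr0 ?sub0r;
   by rewrite ?normrN ?normr1 ?normr0.
have w0 k : (k < N)%N -> w k = 0.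
  move=> kN; rewrite wE /wt'; apply/eqP; rewrite subr_eq0; apply/eqP.
  congr (nat_of_bool _)%:R; apply/idP/idP => [/andP[ik Wik]|].
    by apply/hasP; exists k; rewrite ?mem_iota// ik Wik W_self.
  move=> /[dup] /below_W -> /hasP[j _ /and3P[ij Wij Wjk]]; rewrite andbT.
  exact: leq_trans ij (W_nested Wjk).1.
have -> : ell1_sum b (wt' i) -
    ell1_sum b (fun k => \sum_(j < N) (child i j)%:R * wt j k) = ell1_sum b w.
  have s1 k : `|\sum_(j < N) (child i j)%:R * wt j k| <= 1.
    by rewrite sum_children normr_nat; case: below.
  rewrite addrC -mulN1r -(ell1_sum_linr (-1) b s1 (wt1' i)).
  by congr ell1_sum; apply/funext => k; rewrite mulN1r addrC.
have := ell1_sum_tail b w1 N; rewrite big1 ?subr0 ?mul1r//.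
by move=> k _; rewrite w0 ?mulr0.
Qed.

Lemma masses_atomic b : masses (atomic b) = b.
Proof.
apply: ell1_ext => i; rewrite massesE.
rewrite -(cvg_lim _ (@mass_cvg (atomic b) i))//; apply/cvg_lim => //.
have -> : b i = ell1_sum b (wt i) - ell1_sum b (wt' i).
  by rewrite ell1_sum_self addrK.
apply: cvgB; first by rewrite atomic_gen; exact: cvg_cst.
rewrite (_ : (fun _ => _) =
  fun N => \sum_(j < N) (child i j)%:R * ell1_sum b (wt j)).
  exact: children_sum_cvg.
by apply/funext => N; apply: eq_bigr => j _; rewrite atomic_gen.
Qed.

Hypothesis W_wf : ~ exists s : nat -> nat,
  forall k, (s k < s k.+1)%N && W (s k) (x (s k.+1)).

(** Induction from the leaves, in contrapositive form: if the value on a node is not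
    the sum of the masses at and below it, the same happens at one of its children, and so
    on along an infinite branch. *)
Lemma functional_gen (F : dual VX) i : F (E i) = ell1_sum (masses F) (wt i).
Proof.
apply: contrapT => Pi.
pose P j := F (E j) <> ell1_sum (masses F) (wt j).
have step j : P j -> exists k, child j k /\ P k.
  move=> Pj; apply: contrapT => nP; apply: Pj.
  rewrite ell1_sum_self massesE; apply/eqP; rewrite -subr_eq; apply/eqP/esym.
  rewrite -(cvg_lim _ (@mass_cvg F j))//; apply/cvg_lim => //.
  apply: cvgB; first exact: cvg_cst.
  rewrite (_ : (fun _ => _) =
    fun N => \sum_(k < N) (child j k)%:R * ell1_sum (masses F) (wt k)).
    exact: children_sum_cvg.
  apply/funext => N; apply: eq_bigr => k _; case cjk : (child j k); last by rewrite !mul0r.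
  by congr (_ * _); apply: contrapT => Pk; apply: nP; exists k.
have /choice[f Hf] j : exists k, P j -> child j k /\ P k.
  by have [/step[k Hk]|] := pselect (P j); [exists k|exists 0%N].
apply: W_wf; exists (fun k => iter k f i) => k.
have PI : P (iter k f i) by elim: k => //= k IH; exact: (Hf _ IH).2.
by have [/and3P[-> ->]] := Hf _ PI.
Qed.

Lemma atomic_masses (F : dual VX) : atomic (masses F) = F.
Proof.
apply: dual_ext => v; apply/eqP; rewrite -subr_eq0 -normr_le0.
pose D := atomic (masses F) - F.
have D0 a n : D (lincomb E a n) = 0.
  rewrite -[LHS]/(atomic (masses F) (lincomb E a n) - F (lincomb E a n)).
  rewrite !dual_lincomb -sumrB big1// => i _.
  by rewrite atomic_gen -functional_gen subrr.
rewrite -[X in `|X|]/(D v).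
apply: (@vanishing_eq0 _ _ (fun n => `|D| * n.+1%:R^-1)); last first.
  by apply: vanishingZ => //; exact: vanishing_harmonic.
move=> n; have n0 : 0 < n.+1%:R^-1 :> R by rewrite invr_gt0.
have [a [m Ha]] := csub_mem v _ n0.
have -> : D v = D (v - lincomb E a m) by rewrite dualB D0 subr0.
apply: le_trans (dual_le _ _) _; apply: ler_wpM2l => //.
have {}Ha := ltW Ha; apply: le_trans Ha.
have -> : lincomb e a m = csub_val (lincomb E a m).
  by rewrite csub_lincomb; congr (lincomb _ _ _); apply/funext => i; rewrite EE.
exact: lexx.
Qed.

Theorem forest_dual : isomorphic (dual VX) (ell1 R).
Proof.
apply: isomorphic_sym.
pose f : {linear ell1 R -> dual VX} :=
  HB.pack atomic (GRing.isLinear.Build _ _ _ _ atomic atomic_linear).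
apply: (@isomorphic_bounded R _ _ f masses 1 1).
- exact: masses_atomic.
- exact: atomic_masses.
- by move=> b; rewrite mul1r; exact: atomic_le.
- by move=> F; rewrite mul1r; exact: masses_le.
Qed.

End forest.

(** * Cylinders indexed by finite sequences of natural numbers *)
Section cylinders.
Implicit Types (s t : seq nat) (c : cantor_space).

(** A point of the Cantor space is read as a sequence of rows of bits, and a row as
    the position of its first 1, if there is one.  The cylinder of [t] is the set of
    points whose first rows read [t]; the all-zero rows of [seq_pt t] keep that
    point out of the cylinders of the proper extensions of [t]. *)
Definition first_in_row c (k n : nat) :=
  c (pickle (k, n)) && all (fun i => ~~ c (pickle (k, i))) (iota 0 n).

Definition cyl t c := all (fun k => first_in_row c k (nth 0%N t k)) (iota 0 (size t)).

Definition seq_pt t : cantor_space := fun m =>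
  if unpickle m is Some (k, n) then (k < size t)%N && (n == nth 0%N t k) else false.

Definition branch_pt (b : baire) : cantor_space := fun m =>
  if unpickle m is Some (k, n) then n == b k else false.

Lemma first_in_row_unique c k n m : first_in_row c k n -> first_in_row c k m -> n = m.
Proof.
wlog nm : n m / (n < m)%N.
  by move=> H h h'; have [/H|/H H'|//] := ltngtP n m; [exact|rewrite H'].
move=> /andP[cn _] /andP[_ /allP/(_ n)].
by rewrite mem_iota cn => /(_ nm).
Qed.

Lemma first_in_row_seq_pt t k n :
  first_in_row (seq_pt t) k n = (k < size t)%N && (n == nth 0%N t k).
Proof.
rewrite /first_in_row {1}/seq_pt pickleK; case: (ltnP k (size t)) => //= kt.
case: eqP => //= nE; apply/allP => i; rewrite mem_iota => /andP[_ /= ltin].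
by rewrite /seq_pt pickleK kt -nE ltn_eqF.
Qed.

Lemma first_in_row_branch_pt b k n : first_in_row (branch_pt b) k n = (n == b k).
Proof.
rewrite /first_in_row {1}/branch_pt pickleK; case: eqP => //= nE.
apply/allP => i; rewrite mem_iota => /andP[_ /= ltin].
by rewrite /branch_pt pickleK -nE ltn_eqF.
Qed.

Lemma cylP t c : reflect (forall k, (k < size t)%N -> first_in_row c k (nth 0%N t k)) (cyl t c).
Proof.
apply: (iffP allP) => H k; first by move=> kt; apply: H; rewrite mem_iota.
by rewrite mem_iota => /andP[_ kt]; exact: H.
Qed.

Lemma prefix_nthP s t : reflect
  ((size s <= size t)%N /\ forall k, (k < size s)%N -> nth 0%N s k = nth 0%N t k)
  (prefix s t).
Proof.
rewrite prefixE; apply: (iffP eqP) => [<-|[st H]].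
  rewrite size_take_min; split=> [|k]; first exact: geq_minr.
  by move=> kt; rewrite nth_take// (leq_trans kt)// geq_minl.
have szt : size (take (size s) t) = size s by rewrite size_take_min; apply/minn_idPl.
apply: (@eq_from_nth _ 0%N) => [//|k]; rewrite szt => ks.
by rewrite nth_take// H.
Qed.

Lemma cyl_seq_pt s t : cyl s (seq_pt t) = prefix s t.
Proof.
apply/cylP/prefix_nthP => [H|[st H] k ks]; last first.
  by rewrite first_in_row_seq_pt (leq_trans ks)//= H.
have lts k : (k < size s)%N -> (k < size t)%N.
  by move=> /H; rewrite first_in_row_seq_pt => /andP[].
split=> [|k ks].
  by rewrite leqNgt; apply/negP => /lts; rewrite ltnn.
by apply/eqP; have := H k ks; rewrite first_in_row_seq_pt => /andP[].
Qed.

Lemma cyl_branch_pt s b : cyl s (branch_pt b) <-> s = mkseq b (size s).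
Proof.
split=> [/cylP H|->].
  apply: (@eq_from_nth _ 0%N); rewrite ?size_mkseq// => k ks.
  by rewrite nth_mkseq//; apply/eqP; have := H k ks; rewrite first_in_row_branch_pt.
by apply/cylP => k; rewrite size_mkseq => ks; rewrite first_in_row_branch_pt nth_mkseq.
Qed.

Lemma cyl_prefix s t c : prefix s t -> cyl t c -> cyl s c.
Proof.
move=> /prefix_nthP[st H] /cylP Ht; apply/cylP => k ks.
by rewrite H// Ht// (leq_trans ks).
Qed.

Lemma cyl_meet s t c : cyl s c -> cyl t c -> (size s <= size t)%N -> prefix s t.
Proof.
move=> /cylP Hs /cylP Ht st; apply/prefix_nthP; split=> // k ks.
by apply: first_in_row_unique (Hs _ ks) (Ht _ _); rewrite (leq_trans ks).
Qed.

Lemma cyl_cagree t : exists n, forall c c', cagree n c c' -> cyl t c = cyl t c'.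
Proof.
have [M HM] : exists M, forall k n, (k < size t)%N -> (n <= nth 0%N t k)%N ->
    (pickle (k, n) < M)%N.
  exists (\max_(k < size t) \max_(n < (nth 0%N t k).+1) pickle (val k, val n)).+1.
  move=> k n kt nk; rewrite ltnS.
  apply: leq_trans (leq_bigmax (Ordinal kt)) => /=.
  by rewrite -ltnS in nk; exact: (leq_bigmax (Ordinal nk)).
exists M => c c' cc'; apply/eq_in_all => k; rewrite mem_iota => /andP[_ kt].
rewrite /first_in_row cc' ?HM//; congr (_ && _).
apply/eq_in_all => i; rewrite mem_iota => /andP[_ ik].
by rewrite cc'// HM// ltnW.
Qed.

Lemma mkseq_cons a (f : baire) n :
  mkseq (fun k => if k is k'.+1 then f k' else a) n.+1 = a :: mkseq f n.
Proof. by rewrite /mkseq /= (iotaDl 1 0) -map_comp. Qed.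

Lemma code_prefix s t : prefix s t -> (CodeSeq.code s <= CodeSeq.code t)%N.
Proof.
elim: s t => [//|n s IH] [//|m t] /=.
rewrite eqE/= => /andP[/eqP -> /IH st].
by rewrite leq_mul2l expn_eq0/= ltnS leq_double.
Qed.

(** The tree coded by [z] is moved under the root [0], and an index outside the tree
    gets a one-element sequence of its own.  So all indices are used, whatever the
    size of the tree, and [node z i] depends on [z i] only. *)
Definition node (z : baire) i : seq nat :=
  if z i != 0%N then 0%N :: CodeSeq.decode i else [:: i.+1].

Lemma prefix_node z i j : prefix (node z i) (node z j) -> (i <= j)%N.
Proof.
rewrite /node; case: (z i != 0%N); case: (z j != 0%N) => /=.
- by move=> /code_prefix; rewrite !CodeSeq.decodeK.
- by [].
- by [].
- by rewrite andbT => /eqP[->].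
Qed.

End cylinders.

(** * The space of a tree *)
Section tree_space.
Variable R : realType.

Lemma cyl_continuous t : continuous (fun c => (cyl t c)%:R : R).
Proof.
by have [n Hn] := cyl_cagree t; apply: (@cagree_continuous R n) => c c' /Hn ->.
Qed.

Definition cyl_ind t : ccantor R := ccantor_mk (@cyl_continuous t).

Lemma cyl_indE t c : ccantor_fun (cyl_ind t) c = (cyl t c)%:R.
Proof. by []. Qed.

Definition tree_gen (z : baire) i := cyl_ind (node z i).

Definition tree_space (z : baire) := cspan (tree_gen z).

Lemma tree_space_wf (T : seq nat -> Prop) : (forall s n, T s -> T (take n s)) ->
  (forall x, ~ branch T x) ->
  isomorphic (dual (csub_type (tree_space (tree_code T)))) (ell1 R).
Proof.
move=> Ttake Twf; set z := tree_code T.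
apply: (@forest_dual R (fun i => cyl (node z i)) (fun i => seq_pt (node z i))).
- by move=> i c; exact: cyl_indE.
- by move=> i; rewrite cyl_seq_pt prefix_refl.
- move=> i j; rewrite cyl_seq_pt => ij; split; first exact: prefix_node ij.
  by move=> c; exact: cyl_prefix.
- move=> i j c ij ci cj; rewrite cyl_seq_pt.
  have [le|/ltnW ge] := leqP (size (node z i)) (size (node z j)).
    exact: cyl_meet ci cj le.
  have ji := cyl_meet cj ci ge.
  suff -> : i = j by exact: prefix_refl.
  by apply/eqP; rewrite eqn_leq ij (prefix_node ji).
move=> [s Hs].
have {}Hs k : (s k < s k.+1)%N /\ prefix (node z (s k)) (node z (s k.+1)).
  by have /andP[? +] := Hs k; rewrite cyl_seq_pt.
pose u k := CodeSeq.decode (s k).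
(* The node of an index outside the tree has no proper extension among the nodes, so
   the chain stays in the tree. *)
have zu k : z (s k) != 0%N.
  apply: contraPT (Hs k) => zk [].
  move=> lt; rewrite /node (negbTE zk); case: (z (s k.+1) != 0%N) => //=.
  by rewrite andbT => /eqP[E]; rewrite E ltnn in lt.
have Tu k : T (u k).
  by apply: contraPP (zu k) => nT; rewrite /z /tree_code asboolF// eqxx.
have pu k : prefix (u k) (u k.+1).
  by have [_] := Hs k; rewrite /node !zu.
have su k : (size (u k) < size (u k.+1))%N.
  have /prefix_nthP[le H] := pu k; rewrite ltn_neqAle le andbT; apply/eqP => E.
  have [lt _] := Hs k.
  have uu : u k = u k.+1.
    by apply: (@eq_from_nth _ 0%N).
  have := congr1 CodeSeq.code uu; rewrite !CodeSeq.decodeK => ss.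
  by rewrite ss ltnn in lt.
have sz k : (k <= size (u k))%N by elim: k => // k IH; exact: leq_ltn_trans IH (su k).
have puu k m : prefix (u k) (u (k + m)%N).
  elim: m => [|m IH]; first by rewrite addn0 prefix_refl.
  by rewrite addnS; apply: prefix_trans IH (pu _).
(* The sequences [u k] are nested and of increasing length: their union is a branch. *)
apply: (Twf (fun n => nth 0%N (u n.+1) n)) => n.
have -> : mkseq (fun n => nth 0%N (u n.+1) n) n = take n (u n).
  have szn : size (take n (u n)) = n by rewrite size_takel.
  apply: (@eq_from_nth _ 0%N); rewrite size_mkseq ?szn// => k kn.
  rewrite nth_mkseq// nth_take//.
  have := puu k.+1 (n - k.+1)%N; rewrite subnKC// => /prefix_nthP[_ ->//].
exact: Ttake.
Qed.

(** For two branches whose odd values differ at [k], the indicator function of the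
    cylinder of the first branch up to that place separates the evaluations at their
    limit points. *)
Lemma tree_space_branching (T : seq nat -> Prop) (x : baire) :
  (forall y, branch T (interleave x y)) ->
  ~ isomorphic (dual (csub_type (tree_space (tree_code T)))) (ell1 R).
Proof.
move=> Tb; set z := tree_code T; set V := csub_type (tree_space z).
(* The points where the branches lead, after the shift by the root [0]. *)
pose bp y := branch_pt (fun k => if k is k'.+1 then interleave x y k' else 0%N).
have /choice[d Hd] (y : baire) : exists F : dual V,
    forall v, F v = ccantor_fun (csub_val v) (bp y).
  apply: (@dual_ex _ _ _ 1) => [//|v].
  by rewrite mul1r; exact: ccantor_norm_ge.
apply: (@separated_not_ell1 R _ d) => y y' yy'.
have [k ky] : exists k, y k <> y' k.
  apply: contrapT => H; apply: yy'; apply/funext => k.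
  by apply: contrapT => ky; apply: H; exists k.
pose s := mkseq (interleave x y) k.*2.+2; pose i := CodeSeq.code s.
have zi : node z i = 0%N :: s.
  by rewrite /node /z /tree_code /i CodeSeq.codeK asboolT//; exact: Tb.
have [v vE] : exists v : V, csub_val v = cyl_ind (0%N :: s).
  by apply: csubP; rewrite -zi; exact: cspan_gen.
have v1 : `|v| <= 1.
  rewrite -[`|v|]/(`|csub_val v|) vE; apply: ccantor_norm_le => c.
  by rewrite cyl_indE normr_nat; case: cyl.
have Fv (w : baire) : d w v = (cyl (0%N :: s) (bp w))%:R by rewrite Hd vE cyl_indE.
have szs : size (0%N :: s) = k.*2.+3 by rewrite -[LHS]/(size s).+1 size_mkseq.
have -> : 1 = `|(d y - d y') v| :> R.
  rewrite -[(d y - d y') v]/(d y v - d y' v) !Fv.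
  have -> : cyl (0%N :: s) (bp y).
    by apply/cyl_branch_pt; rewrite szs mkseq_cons.
  have -> : cyl (0%N :: s) (bp y') = false.
    apply/negP => /cylP/(_ k.*2.+2); rewrite szs => /(_ (ltnSn _)).
    rewrite -[nth _ _ _]/(nth 0%N s k.*2.+1) nth_mkseq// interleave_odd.
    by rewrite first_in_row_branch_pt interleave_odd => /eqP.
  by rewrite subr0 normr1.
by apply: le_trans (dual_le _ _) _; rewrite ler_piMr.
Qed.

End tree_space.

(** * Coding the points of a Polish space *)
Section polish_coding.
Variables (R : realType) (P : completePseudoMetricType R).
Hypothesis P_hausdorff : hausdorff_space P.
Variable d : nat -> P.
Hypothesis d_dense : forall (p : P) (e : R), 0 < e -> exists k, ball (d k) e p.

Let h n : R := n.+1%:R^-1.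
Let h0 n : 0 < h n. Proof. by rewrite invr_gt0. Qed.
Let hv : vanishing h. Proof. exact: vanishing_harmonic. Qed.

(** [y] codes a point through a sequence of points [d (y k)] of the dense set that
    converges to it.  Validity is a closed condition because each clause involves
    finitely many values of [y].  The limit may leave the open balls of radius [h k],
    but lies in those of radius [2 * h k], as [codes_point] requires. *)
Definition valid_code (y : baire) := forall n, exists p,
  forall k, (k < n)%N -> ball (d (y k)) (h k) p.

Definition codes_point (y : baire) p := forall k, ball (d (y k)) (2 * h k) p.

Lemma valid_code_ex y : valid_code y -> exists p, codes_point y p.
Proof.
move=> vy.
have near_ k m : ball (d (y k)) (h k + h m) (d (y m)).
  have [p Hp] := vy (maxn k m).+1.
  apply: (@ball_triangle _ _ p); first by apply: Hp; rewrite ltnS leq_maxl.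
  by apply: ball_sym; apply: Hp; rewrite ltnS leq_maxr.
have cvgy : cvg ((d \o y) @ \oo).
  apply: cauchy_cvg; apply: cauchy_exP => e e0.
  have e2 : 0 < e / 2 by rewrite divr_gt0.
  have [N HN] := hv e2; exists (d (y N)); exists N => // m /= Nm.
  apply: le_ball (near_ N m); rewrite (splitr e) lerD// ltW//; exact: HN.
exists (lim ((d \o y) @ \oo)) => k.
have k2 : 0 < h k / 2 by rewrite divr_gt0.
have [N HN] := hv k2.
have /cvg_ballP/(_ _ k2)[M _ HM] := cvgy.
have /= Hl := HM (maxn N M) (leq_maxr _ _).
have := ball_triangle (near_ k (maxn N M)) (ball_sym Hl).
apply: le_ball; have := HN _ (leq_maxl N M); lra.
Qed.

Lemma valid_code_surj p : exists2 y, valid_code y & codes_point y p.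
Proof.
have /choice[y Hy] k : exists i, ball (d i) (h k) p by exact: d_dense.
exists y; first by move=> n; exists p.
move=> k; apply: le_ball (Hy k).
by rewrite mulr_natl mulr2n lerDl ltW.
Qed.

Lemma codes_point_open y p (U : set P) : open U -> codes_point y p -> U p ->
  exists k, forall p', ball (d (y k)) (2 * h k) p' -> U p'.
Proof.
move=> oU yp Up; have /nbhs_ballP[e /= e0 eU] := open_nbhs_nbhs (conj oU Up).
have e4 : 0 < e / 4 by rewrite divr_gt0.
have [k /(_ k (leqnn k)) hk] := hv e4; exists k => p' yp'.
apply: eU; have := ball_triangle (ball_sym (yp k)) yp'.
by apply: le_ball; lra.
Qed.

Lemma codes_point_unique y p p' : codes_point y p -> codes_point y p' -> p = p'.
Proof.
move=> yp yp'; apply: (close_eq P_hausdorff); rewrite ball_close => e.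
have e4 : 0 < e%:num / 4 by [].
have [k /(_ k (leqnn k)) hk] := hv e4.
have := ball_triangle (ball_sym (yp k)) (yp' k).
by apply: le_ball; lra.
Qed.

Definition codes_in (B : set P) (y : baire) := valid_code y /\ exists2 p, codes_point y p & B p.

Lemma souslin_valid_code : souslin valid_code.
Proof.
apply: souslin_closed => y Hy n; have [y' yy' vy'] := Hy n.
have [p Hp] := vy' n; exists p => k kn; rewrite yy'//; exact: Hp.
Qed.

Lemma souslin_in_open U : open U -> souslin (codes_in U).
Proof.
move=> oU.
apply: (@souslin_ext (fun y => valid_code y /\
  exists k, forall p', ball (d (y k)) (2 * h k) p' -> U p')).
  move=> y; split=> -[vy].
    by move=> [k Hk]; split=> //; have [p yp] := valid_code_ex vy; exists p => //; exact: Hk.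
  by move=> [p yp Up]; split=> //; exact: codes_point_open yp Up.
apply: souslinI souslin_valid_code _; apply: souslin_open => y [k Hk].
by exists k.+1 => y' yy'; exists k; rewrite -yy'.
Qed.

Lemma souslin_in_openC U : open U -> souslin (codes_in (~` U)).
Proof.
move=> oU.
apply: (@souslin_ext (fun y => valid_code y /\
  ~ exists k, forall p', ball (d (y k)) (2 * h k) p' -> U p')).
  move=> y; split=> -[vy].
    move=> nU; split=> //; have [p yp] := valid_code_ex vy; exists p => // Up.
    exact/nU/(codes_point_open oU yp Up).
  by move=> [p yp nUp]; split=> // -[k Hk]; apply: nUp; exact: Hk.
apply: souslinI souslin_valid_code _; apply: souslin_closed => y Hy [k Hk].
have [y' yy' []] := Hy k.+1; exists k => p'; rewrite -yy'//; exact: Hk.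
Qed.

(** The sets [B] for which the codes of the points of [B], and those of the points
    outside [B], form Souslin sets are a sigma-algebra containing the open sets. *)
Lemma souslin_in_borel B : <<s [set U : set P | open U] >> B ->
  souslin (codes_in B) /\ souslin (codes_in (~` B)).
Proof.
pose G := [set B : set P | souslin (codes_in B) /\ souslin (codes_in (~` B))].
suff sG : sigma_algebra setT G.
  move=> HB; suff : G B by [].
  apply: HB; split=> // U oU; split; [exact: souslin_in_open|exact: souslin_in_openC].
split.
- split; last by rewrite setC0; exact/souslin_in_open/openT.
  exact/souslin_in_open/open0.
- move=> A [sA sCA]; rewrite setTD; split=> //.
  by rewrite setCK.
- move=> A HA; split.
    apply: (@souslin_ext (fun y => exists n, codes_in (A n) y)).
      move=> y; split=> [[n [vy [p yp Ap]]]|[vy [p yp [n _ Ap]]]].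
        by split=> //; exists p => //; exists n.
      by exists n; split=> //; exists p.
    by apply: souslin_cup => n; have [] := HA n.
  apply: (@souslin_ext (fun y => forall n, codes_in (~` A n) y)).
    move=> y; split=> [H|[vy [p yp nA]] n]; last first.
      by split=> //; exists p => // Ap; apply: nA; exists n.
    have [vy [p yp _]] := H 0%N; split=> //; exists p => // -[n _ Ap].
    by have [_ [p' yp' nAp']] := H n; rewrite (codes_point_unique yp yp') in Ap.
  by apply: souslin_cap => n; have [] := HA n.
Qed.

End polish_coding.

(** * Analytic classes of spaces and Souslin sets of trees *)
Section tree_space_souslin.
Variable R : realType.

Definition meets (X : closed_subspace (ccantor R)) (U : set (ccantor R)) :=
  csub_set X `&` U !=set0.

(** A closed subspace is determined by the balls of a countable base that it
    meets. *)
Lemma meets_base : exists U : nat -> set (ccantor R), (forall n, open (U n)) /\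
  forall X Y, (forall n, meets X (U n) <-> meets Y (U n)) -> X = Y.
Proof.
have [d Hd] := ccantor_separable R.
exists (fun n => if unpickle n is Some (k, m) then ball (d k) (m.+1%:R^-1) else setT).
split=> [n|X Y XY].
  by case: (unpickle n) => [[k m]|]; [exact: ball_open|exact: openT].
suff sub X' Y' : (forall n : nat, meets X' (if unpickle n is Some (k, m) then
    ball (d k) (m.+1%:R^-1) else setT) -> meets Y' (if unpickle n is Some (k, m) then
    ball (d k) (m.+1%:R^-1) else setT)) -> forall v, csub_set X' v -> csub_set Y' v.
  by apply: closed_subspace_ext => v; split; apply: sub => n /XY.
move=> H v Xv; apply: closed_subspace_approx => e e0.
have e2 : 0 < e / 2 by rewrite divr_gt0.
have [m /(_ m (leqnn m)) Hm] := @vanishing_harmonic R _ e2.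
have [k Hk] := Hd v (m.+1%:R^-1) ltac:(by rewrite invr_gt0).
have := H (pickle (k, m)); rewrite pickleK => -[].
  by exists v; split=> //; rewrite -ball_normE/= distrC.
move=> w [Yw]; rewrite -ball_normE/= => wk; exists w => //.
rewrite -(subrK (d k) v) -addrA (le_lt_trans (ler_normD _ _))// (splitr e).
by rewrite ltrD// (lt_trans _ Hm).
Qed.

Lemma tree_space_meets z (U : set (ccantor R)) : open U -> meets (tree_space R z) U ->
  exists n, forall z', agree n z z' -> meets (tree_space R z') U.
Proof.
move=> oU /(cspan_meets _ oU)[q Uq]; exists (size q) => z' zz'.
apply/(cspan_meets _ oU); exists q.
suff -> : ratcomb (tree_gen R z') q = ratcomb (tree_gen R z) q by [].
by apply: eq_bigr => i _; rewrite /tree_gen /node zz'.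
Qed.

(** The condition [f t = tree_space z] says that the two spaces meet the same sets of
    a countable base.  On the side of [t] this is a Borel condition on the point of
    the Polish space, hence Souslin on its codes; on the side of [z] it is an open
    condition or the negation of one.  The code of [t] is then projected out. *)
Lemma analytic_souslin (A : set (SB R)) : analytic R A ->
  souslin (fun z => A (tree_space R z)).
Proof.
move=> [->|[d' [T [f [[P [phi [hP [D cD dD] bphi mT]]] mf ->]]]]].
  by apply: souslin_open => z [].
have [d Hd] : exists d : nat -> P, forall p (e : R), 0 < e -> exists k, ball (d k) e p.
  have Dp (p : P) (e : R) : 0 < e -> exists2 x, D x & ball x e p.
    move=> e0; have [x [xe Dx]] : (ball p e)^° `&` D !=set0.
      by apply: dD; [exists p; exact: nbhsx_ballx|exact: open_interior].
    by exists x => //; apply: ball_sym; exact: interior_subset xe.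
  have /pfcard_geP[D0|[g]] := cD.
    have [x] := Dp point 1 ltr01; by rewrite D0.
  exists g => p e /(Dp p)[x Dx xe].
  by have [k _ kx] := @surj _ _ _ _ g _ Dx; exists k; rewrite kx.
have [psi phiK psiK] := bphi.
have [U [oU Uext]] := meets_base.
have /choice[C HC] n : exists C : set P, <<s [set U : set P | open U] >> C /\
    forall t, meets (f t) (U n) <-> C (phi t).
  have mB : measurable ([set X | meets X (U n)] : set (SB R)).
    by apply: sub_gen_smallest; exists (U n) => //; exact: oU.
  have := mf measurableT _ mB; rewrite setTI mT => -[C bC CE]; exists C; split=> // t.
  by rewrite -[C (phi t)]/((phi @^-1` C) t) CE; exact: iff_refl.
pose O n z := meets (tree_space R z) (U n).
have sO n : souslin (O n) by apply: souslin_open => z; exact: tree_space_meets.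
have sOC n : souslin (fun z => ~ O n z).
  apply: souslin_closed => z Hz /(tree_space_meets (oU n))[m Hm].
  by have [z' zz' nO] := Hz m; exact/nO/Hm.
pose sC n := souslin_in_borel hP d (HC n).1.
pose G w := forall n, (codes_in d (C n) (fun i => w i.*2.+1) /\ O n (fun i => w i.*2)) \/
                      (codes_in d (~` C n) (fun i => w i.*2.+1) /\ ~ O n (fun i => w i.*2)).
have sG : souslin G.
  apply: souslin_cap => n; apply: souslinU; apply: souslinI.
  - exact: (souslin_reindex (fun i => i.*2.+1) (sC n).1).
  - exact: (souslin_reindex (fun i => i.*2) (sO n)).
  - exact: (souslin_reindex (fun i => i.*2.+1) (sC n).2).
  - exact: (souslin_reindex (fun i => i.*2) (sOC n)).
apply: souslin_ext (souslin_proj sG) => z.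
have left y : (fun i => interleave z y i.*2) = z.
  by apply/funext => i; rewrite interleave_even.
have right y : (fun i => interleave z y i.*2.+1) = y.
  by apply/funext => i; rewrite interleave_odd.
split=> [[y Gy]|[t _ ft]]; last first.
  have [y vy yp] := valid_code_surj Hd (phi t); exists y => n; rewrite left right.
  have Cn : C n (phi t) <-> O n z by rewrite -(HC n).2 ft.
  have [On|nOn] := pselect (O n z); [left|right]; do 2 split=> //.
    by exists (phi t) => //; apply/Cn.
  by exists (phi t) => // /Cn.
have [p yp] : exists p, codes_point d y p.
  by have := Gy 0%N; rewrite right => -[[[_ [p yp _]] _]|[[_ [p yp _]] _]]; exists p.
exists (psi p) => //; apply: Uext => n; rewrite (HC n).2 psiK.
have := Gy n; rewrite left right => -[[[_ [p' yp' Cp']] Oz]|[[_ [p' yp' Cp']] nOz]].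
  by rewrite (codes_point_unique hP yp yp'); split.
by rewrite (codes_point_unique hP yp yp'); split=> [/Cp'|/nOz].
Qed.
End tree_space_souslin.

(** * The Baire space as a complete metric space *)

(** The Baire space is indexed by the field in which its distances are measured. *)
Definition baire_space (R : realType) : Type := nat -> nat.

Section baire_space.
Variable R : realType.
Local Notation B := (baire_space R).

HB.instance Definition _ := Pointed.on B.

(** The ball of radius [e] is the set of sequences that agree with [x] at every [k]
    with [e <= 1 / (k + 1)]. *)
Definition baire_ball (x : B) (e : R) (y : B) :=
  0 < e /\ forall k, e <= k.+1%:R^-1 -> x k = y k.

Let ent := entourage_ baire_ball.

Let ball_center x (e : R) : 0 < e -> baire_ball x e x.
Proof. by []. Qed.

Let ball_sym x y (e : R) : baire_ball x e y -> baire_ball y e x.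
Proof. by move=> [e0 xy]; split=> // k /xy. Qed.

Let ball_triangle x y z e1 e2 : baire_ball x e1 y -> baire_ball y e2 z ->
  baire_ball x (e1 + e2) z.
Proof.
move=> [e10 xy] [e20 yz]; split=> [|k ek]; first exact: addr_gt0.
by rewrite xy ?yz//; apply: le_trans ek; rewrite ?lerDl ?lerDr ltW.
Qed.

HB.instance Definition _ := hasNbhs.Build B (nbhs_ ent).
HB.instance Definition _ := @Nbhs_isPseudoMetric.Build R B
  ent erefl baire_ball ball_center ball_sym ball_triangle erefl.

Lemma agree_ball (x : B) (e : R) : 0 < e -> exists n, forall y : B, agree n x y -> ball x e y.
Proof.
move=> e0; have [N HN] := @vanishing_harmonic R e e0.
exists N => y xy; split=> // k; have [/HN|kN] := leqP N k; last by move=> _; exact: xy.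
by rewrite ltNge => /negP.
Qed.

Lemma ball_agree (x y : B) n : ball x (n.+1%:R^-1 : R) y -> agree n.+1 x y.
Proof.
by move=> [_ H] k kn; apply: H; rewrite lef_pV2 ?posrE// ler_nat.
Qed.

Lemma baire_open (U : set B) :
  (forall x, U x -> exists n, forall y, agree n x y -> U y) -> open U.
Proof.
move=> HU; rewrite openE => x /HU[n Hn]; apply/nbhs_ballP.
exists (n.+1%:R^-1) => /=; first by rewrite invr_gt0.
by move=> y /ball_agree xy; apply: Hn; exact: agree_le xy.
Qed.

Lemma baire_hausdorff : hausdorff_space B.
Proof.
rewrite ball_hausdorff => x y xy.
have [k xyk] : exists k, x k <> y k.
  apply: contrapT => H; move/eqP : xy; apply; apply/funext => k.
  by apply: contrapT => ?; apply: H; exists k.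
have k0 : 0 < k.+1%:R^-1 :> R by rewrite invr_gt0.
exists (PosNum k0, PosNum k0); apply/eqP; rewrite -subset0 => z /= [].
by move=> /ball_agree/(_ k (ltnSn k)) xz /ball_agree/(_ k (ltnSn k)) yz; rewrite xz yz in xyk.
Qed.

Lemma baire_separable : separable_space B.
Proof.
exists (range (fun s : seq nat => nth 0%N s : B)).
  by apply: sub_countable (countableP _); exact: card_image_le.
move=> O [x Ox] oO.
have /nbhs_ballP[e /= e0 eO] := open_nbhs_nbhs (conj oO Ox).
have [n Hn] := agree_ball x e0.
exists (nth 0%N (mkseq x n)); split; last by exists (mkseq x n).
by apply/eO/Hn => i ni; rewrite nth_mkseq.
Qed.

Lemma baire_complete (F : set_system B) : ProperFilter F -> cauchy F -> cvg F.
Proof.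
move=> FF /cauchyP cF.
have /choice[x Hx] n : exists x : B, F (ball x (n.+1%:R^-1 : R)).
  by apply: cF; rewrite invr_gt0.
apply/cvg_ex; exists (fun k => x k k : nat); apply/cvg_ballP => e e0.
have [N HN] := agree_ball (fun k => x k k : nat) e0.
have FN : F [set y : B | forall k, (k < N)%N -> ball (x k) (k.+1%:R^-1 : R) y].
  elim: N {HN} => [|N IH]; first by apply: filterS (@filterT _ F _).
  apply: filterS2 IH (Hx N) => y IH HN k; rewrite ltnS leq_eqVlt => /orP[/eqP->//|].
  exact: IH.
apply: filterS FN => y Hy; apply: HN => k /Hy /ball_agree; exact.
Qed.

HB.instance Definition _ := Uniform_isComplete.Build B baire_complete.

End baire_space.

(** * A copy of ell1 in C(2^N) *)
Section rademacher.
Variable R : realType.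

Lemma rademacher_continuous n :
  continuous (fun c : cantor_space => if c n then 1 else -1 : R).
Proof. by apply: (@cagree_continuous R n.+1) => c c' ->. Qed.

Definition rademacher n : ccantor R := ccantor_mk (rademacher_continuous (n := n)).

Lemma rademacher_basis : ell1_basis 1 1 rademacher.
Proof.
split=> [a n|i]; last first.
  apply: ccantor_norm_le => c; rewrite -[ccantor_fun _ c]/(if c i then 1 else -1 : R).
  by case: ifP; rewrite ?normrN normr1.
rewrite mul1r; pose c : cantor_space := fun i => 0 <= a i.
apply: le_trans (ccantor_norm_ge _ c); apply: le_trans (ler_norm _).
rewrite ccantor_sum; apply: ler_sum => i _.
rewrite -[ccantor_fun _ c]/(if 0 <= a i then 1 else -1 : R).
by have [ai|ai] := leP 0 (a i); [rewrite mulr1 ger0_norm|rewrite mulrN1 ltr0_norm].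
Qed.

Lemma rademacher_ell1 : isomorphic (csub_type (cspan rademacher)) (ell1 R).
Proof. exact: ell1_basis_isomorphic ltr01 rademacher_basis. Qed.

End rademacher.

(** * The isomorphism class of ell1 is analytic *)
Section ell1_analytic.
Variable R : realType.
Variable d : nat -> ccantor R.
Hypothesis d_dense : forall v (e : R), 0 < e -> exists k, `|v - d k| < e.

Let h n : R := n.+1%:R^-1.
Let h0 n : 0 < h n. Proof. by rewrite invr_gt0. Qed.
Let hv : vanishing h. Proof. exact: vanishing_harmonic. Qed.

(** A code [s] consists of a bound for the equivalence constants, given by its value
    at [pickle (0, 0)], and of the sequences of indices of the approximants in the dense
    set: [approx s k i] is the one of order [k] to the [i]-th basis vector. *)
Definition code_bound (s : baire) : R := (s (pickle (0%N, 0%N))).+1%:R.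
Definition approx (s : baire) (k i : nat) := d (s (pickle (i.+1, k))).

Lemma code_bound_gt0 s : 0 < code_bound s. Proof. by []. Qed.

(** The three clauses say that the approximants are Cauchy at the prescribed rate and
    that their limits satisfy the lower and upper ell1 estimates.  The estimates are
    stated for the approximants, with an error term, so that every instance involves
    finitely many values of [s]. *)
Definition codes_basis s := [/\
  forall i j k, (j <= k)%N -> `|approx s k i - approx s j i| <= h j,
  forall a n k, (code_bound s)^-1 * psum a n <= `|lincomb (approx s k) a n| + h k * psum a n &
  forall i k, `|approx s k i| <= code_bound s + h k].

Definition represents s (y : nat -> ccantor R) := forall i k, `|y i - approx s k i| <= h k.

Lemma lincomb_close (y y' : nat -> ccantor R) (e : R) a n :
  (forall i, `|y i - y' i| <= e) -> `|lincomb y a n - lincomb y' a n| <= e * psum a n.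
Proof.
move=> He; have -> : lincomb y a n - lincomb y' a n = lincomb (fun i => y i - y' i) a n.
  by rewrite /lincomb -sumrB; apply: eq_bigr => i _; rewrite scalerBr.
exact: lincomb_le.
Qed.

Lemma represents_lincomb s y a n k : represents s y ->
  `|lincomb y a n - lincomb (approx s k) a n| <= h k * psum a n.
Proof. by move=> sy; apply: lincomb_close => i; exact: sy. Qed.

Lemma represents_unique s y y' : represents s y -> represents s y' -> y = y'.
Proof.
move=> sy sy'; apply/funext => i; apply/eqP; rewrite -subr_eq0 -normr_le0.
apply: (@vanishing_eq0 _ _ (fun k => 2 * h k)); last first.
  by apply: vanishingZ => // k; exact: ltW.
move=> k; have -> : y i - y' i = (y i - approx s k i) - (y' i - approx s k i).
  by rewrite opprB addrA subrK.
by rewrite (le_trans (ler_normB _ _))// mulr_natl mulr2n lerD.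
Qed.

Lemma codes_basis_ex s : codes_basis s ->
  exists2 y, represents s y & ell1_basis (code_bound s)^-1 (code_bound s) y.
Proof.
move=> [s1 s2 s3].
have /choice[y sy] i : exists l, forall k, `|l - approx s k i| <= h k.
  by apply: ccantor_complete => // j k; exact: s1.
exists y => //; split=> [a n|i]; rewrite -subr_le0.
  apply: (@vanishing_eq0 _ _ (fun k => (2 * psum a n) * h k)); last first.
    by apply: vanishingZ => //; [move=> k; exact: ltW|rewrite mulr_ge0// psum_ge0].
  move=> k; have := s2 a n k; have := represents_lincomb a n k sy.
  have : `|lincomb (approx s k) a n| <= `|lincomb y a n| +
      `|lincomb y a n - lincomb (approx s k) a n|.
    rewrite -{1}(subrK (lincomb y a n) (lincomb (approx s k) a n)) addrC.
    by rewrite (le_trans (ler_normD _ _))// lerD2l distrC.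
  have -> : 2 * psum a n * h k = 2 * (h k * psum a n) by ring.
  move: (`|lincomb y a n - _|) (`|lincomb (approx s k) a n|) (`|lincomb y a n|)
    (h k * psum a n) ((code_bound s)^-1 * psum a n) => r1 r2 r3 r4 r5; lra.
apply: (@vanishing_eq0 _ _ (fun k => 2 * h k)); last first.
  by apply: vanishingZ => // k; exact: ltW.
move=> k; have := s3 i k; have := sy i k.
have : `|y i| <= `|y i - approx s k i| + `|approx s k i|.
  by rewrite -{1}(subrK (approx s k i) (y i)) ler_normD.
lra.
Qed.

(** Approximants within half of the prescribed error make the sequences Cauchy at the
    prescribed rate. *)
Lemma ell1_basis_coded c M y : 0 < c -> ell1_basis c M y ->
  exists2 s, codes_basis s & represents s y.
Proof.
move=> c0 [ylow yM].
have /choice[g Hg] p : exists k, `|y p.1 - d k| < h p.2 / 2.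
  by apply: d_dense; rewrite divr_gt0.
have [K HK] : exists K : nat, c^-1 + M <= K.+1%:R.
  exists (Num.truncn (c^-1 + M)); exact/ltW/truncnS_gt.
have M0 : 0 <= M by exact: le_trans (yM 0%N).
pose s := unrows (fun r k => if r is i.+1 then g (i, k) else K).
have sE r k : s (pickle (r, k)) = if r is i.+1 then g (i, k) else K.
  by have := unrowsK (fun r k => if r is i.+1 then g (i, k) else K) r => /(congr1 (fun f => f k)).
have aE i k : approx s k i = d (g (i, k)) by rewrite /approx sE.
have bE : code_bound s = K.+1%:R by rewrite /code_bound sE.
have close i k : `|y i - approx s k i| <= h k / 2.
  by rewrite aE ltW//; exact: (Hg (i, k)).
have rep : represents s y.
  by move=> i k; rewrite (le_trans (close i k))// ler_pdivrMr// ler_peMr// ?ler1n// ltW.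
exists s => //; split=> [i j k jk|a n k|i k].
- have -> : approx s k i - approx s j i = (y i - approx s j i) - (y i - approx s k i).
    by rewrite opprB [RHS]addrC addrA subrK.
  rewrite (le_trans (ler_normB _ _))// (le_trans (lerD (close _ _) (close _ _)))//.
  have : h k <= h j by rewrite /h lef_pV2 ?posrE// ler_nat.
  lra.
- have := ylow a n; have := represents_lincomb a n k rep.
  have : `|lincomb y a n| <= `|lincomb (approx s k) a n| +
      `|lincomb y a n - lincomb (approx s k) a n|.
    rewrite -{1}(subrK (lincomb (approx s k) a n) (lincomb y a n)) addrC.
    exact: ler_normD.
  have : (code_bound s)^-1 * psum a n <= c * psum a n.
    rewrite ler_wpM2r ?psum_ge0// bE -[leRHS]invrK lef_pV2 ?posrE ?invr_gt0//.
    by apply: le_trans HK; rewrite lerDl.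
  move: (`|lincomb y a n - _|) (`|lincomb (approx s k) a n|) (`|lincomb y a n|)
    (h k * psum a n) ((code_bound s)^-1 * psum a n) (c * psum a n).
  by move=> r1 r2 r3 r4 r5 r6; lra.
- have : `|approx s k i| <= `|y i| + `|y i - approx s k i|.
    rewrite -{1}(subrK (y i) (approx s k i)) addrC (le_trans (ler_normD _ _))//.
    by rewrite lerD2l distrC.
  have := rep i k; have := yM i.
  have : M <= code_bound s by rewrite bE; apply: le_trans HK; rewrite lerDr invr_ge0 ltW.
  lra.
Qed.

Lemma bounded_approx n k : exists m, forall s s' : baire, agree m s s' ->
  forall i, (i < n)%N -> approx s k i = approx s' k i.
Proof.
have [m Hm] := bounded_prefix (fun i => pickle (i.+1, k)) n.
by exists m => s s' ss' i ni; rewrite /approx ss'// Hm.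
Qed.

Lemma lincomb_ext (y y' : nat -> ccantor R) a n :
  (forall i, (i < n)%N -> y i = y' i) -> lincomb y a n = lincomb y' a n.
Proof. by move=> yy'; apply: eq_bigr => i _; rewrite yy'. Qed.

Lemma codes_basis_closed s : (forall n, exists2 s', agree n s s' & codes_basis s') -> codes_basis s.
Proof.
move=> Hs.
have bE s' m : agree m s s' -> (pickle (0%N, 0%N) < m)%N -> code_bound s = code_bound s'.
  by move=> ss' lt; rewrite /code_bound ss'.
split=> [i j k jk|a n k|i k].
- have [m1 H1] := bounded_approx i.+1 j; have [m2 H2] := bounded_approx i.+1 k.
  have [s' ss' [+ _ _]] := Hs (maxn m1 m2) => /(_ i _ _ jk).
  by rewrite -(H1 s s' (agree_le (leq_maxl _ _) ss') i (ltnSn i))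
    -(H2 s s' (agree_le (leq_maxr _ _) ss') i (ltnSn i)).
- have [m H] := bounded_approx n k.
  have [s' ss' [_ + _]] := Hs (maxn m (pickle (0%N, 0%N)).+1) => /(_ a n k).
  rewrite -(bE s' _ ss') ?leq_maxr//.
  by rewrite -(@lincomb_ext (approx s k))//; apply: H; exact: agree_le (leq_maxl _ _) ss'.
- have [m H] := bounded_approx i.+1 k.
  have [s' ss' [_ _ +]] := Hs (maxn m (pickle (0%N, 0%N)).+1) => /(_ i k).
  rewrite -(bE s' _ ss') ?leq_maxr//.
  by rewrite -(H s s' (agree_le (leq_maxl _ _) ss') i (ltnSn i)).
Qed.

(** The span of the Rademacher functions is the default value, so that the range is
    contained in the class of ell1. *)
Definition decode_space (s : baire) : closed_subspace (ccantor R) :=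
  if pselect (codes_basis s) is left H then cspan (s2val (cid2 (codes_basis_ex H)))
  else cspan (rademacher R).

(** Some approximate rational combination lies so deep in [U] that its error does not
    matter; for the codes of bases this means that the span meets [U]. *)
Definition meets_code (U : set (ccantor R)) (s : baire) := exists q k,
  forall v, `|v - ratcomb (approx s k) q| <=
    h k * psum (fun i => ratr q`_i : R) (size q) -> U v.

Lemma meets_code_open U s : meets_code U s ->
  exists n, forall s', agree n s s' -> meets_code U s'.
Proof.
move=> [q [k H]]; have [m Hm] := bounded_approx (size q) k.
exists m => s' ss'; exists q, k => v.
by rewrite /ratcomb -(@lincomb_ext (approx s k))//; [exact: H|exact: Hm].
Qed.

Lemma meets_codeP U s y : open U -> represents s y ->
  meets (cspan y) U <-> meets_code U s.
Proof.
move=> oU sy; rewrite /meets (cspan_meets _ oU); split=> [[q Uq]|[q [k H]]]; exists q.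
  have [e e0 eU] := open_normP oU Uq.
  pose S := psum (fun i => ratr q`_i : R) (size q).
  have S0 : 0 <= S by exact: psum_ge0.
  have e2 : 0 < e / (2 * S + 1) by rewrite divr_gt0// ltr_wpDl// mulr_ge0.
  have [k /(_ k (leqnn k)) hk] := hv e2; exists k => v Hv; apply: eU.
  move: hk; rewrite ltr_pdivlMr; last by rewrite ltr_wpDl// mulr_ge0.
  have := represents_lincomb (fun i => ratr q`_i) (size q) k sy; rewrite -/S.
  have : `|ratcomb y q - v| <= `|ratcomb y q - ratcomb (approx s k) q| +
      `|v - ratcomb (approx s k) q|.
    by rewrite -{1}(subrK (ratcomb (approx s k) q) (ratcomb y q)) -addrA
       (le_trans (ler_normD _ _))// lerD2l distrC.
  have := h0 k; rewrite /ratcomb in Hv *; rewrite -/S in Hv; nra.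
by apply: H; exact: represents_lincomb.
Qed.

Lemma decode_space_meets U : open U -> measurable
  ([set s | meets (decode_space s) U] :
    set (g_sigma_algebraType [set V : set (baire_space R) | open V])).
Proof.
move=> oU.
pose T := g_sigma_algebraType [set V : set (baire_space R) | open V].
have mopen (V : set T) : (forall s, V s -> exists n, forall s', agree n s s' -> V s') ->
    measurable V.
  by move=> HV; apply: sub_gen_smallest; exact: baire_open.
have mgood : measurable (codes_basis : set T).
  rewrite -[codes_basis]setCK; apply: measurableC; apply: mopen => s ngs.
  apply: contrapT => H; apply: ngs; apply: codes_basis_closed => n.
  apply: contrapT => Hn; apply: H; exists n => s' ss' gs'; apply: Hn; by exists s'.
have mcode : measurable (meets_code U : set T) by apply: mopen => s; exact: meets_code_open.
rewrite (_ : [set s | _] = ((codes_basis : set T) `&` meets_code U) `|`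
   (~` (codes_basis : set T) `&` [set s | meets (cspan (rademacher R)) U])).
  apply: measurableU; apply: measurableI => //; first exact: measurableC.
  have [H|H] := pselect (meets (cspan (rademacher R)) U).
    suff -> : [set s : T | meets (cspan (rademacher R)) U] = setT by exact: measurableT.
    by apply/seteqP; split.
  suff -> : [set s : T | meets (cspan (rademacher R)) U] = set0 by exact: measurable0.
  by apply/seteqP; split.
apply/seteqP; split=> s /=; rewrite /decode_space; case: pselect => gs.
- by case: cid2 => y sy yb /=; rewrite (meets_codeP oU sy); left.
- by right.
- by case: cid2 => y sy yb /=; rewrite (meets_codeP oU sy) => -[[]|[]].
- by move=> [[]|[]].
Qed.

Lemma decode_space_ell1 s : isomorphic (csub_type (decode_space s)) (ell1 R).
Proof.
rewrite /decode_space; case: pselect => gs; last exact: rademacher_ell1.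
case: cid2 => y sy yb /=; apply: ell1_basis_isomorphic yb.
by rewrite invr_gt0 code_bound_gt0.
Qed.

Lemma decode_space_surj Y : isomorphic (csub_type Y) (ell1 R) ->
  exists s, decode_space s = Y.
Proof.
move=> /isomorphic_ell1_basis[c [M [y [c0 yb ->]]]].
have [s gs sy] := ell1_basis_coded c0 yb; exists s.
rewrite /decode_space; case: pselect => // {}gs.
by case: cid2 => y' sy' _ /=; rewrite (represents_unique sy sy').
Qed.

Lemma ell1_class_analytic :
  analytic R ([set Y | isomorphic (csub_type Y) (ell1 R)] : set (SB R)).
Proof.
right; pose G := [set V : set (baire_space R) | open V].
exists _, (g_sigma_algebraType G), decode_space; split.
- exists (baire_space R), id; split; [exact: baire_hausdorff|exact: baire_separable| |].
    by exists id.
  by apply/seteqP; split=> [V mV|_ [V mV <-]]; [exists V|].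
- apply: (@measurability _ _ (g_sigma_algebraType G) (SB R) setT decode_space
    (effros (ccantor R))) => // _ [_ [U oU <-] <-].
  by rewrite setTI; exact: decode_space_meets.
- apply/seteqP; split=> [Y /decode_space_surj[s <-]|_ [s _ <-]]; first by exists s.
  exact: decode_space_ell1.
Qed.

End ell1_analytic.

Theorem mainTheorem2 (R : realType) :
  let A : set (SB R) := [set Y | isomorphic (csub_type Y) (ell1 R)] in
  let A_star : set (SB R) :=
    [set X | exists Y : SB R,
       A Y /\ isomorphic (dual (csub_type X)) (csub_type Y)] in
  [/\ analytic R A,
      A_star = [set X | isomorphic (dual (csub_type X)) (ell1 R)] &
      ~ analytic R A_star].
Proof.
move=> A A_star.
have A_starE : A_star = [set X | isomorphic (dual (csub_type X)) (ell1 R)].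
  apply/seteqP; split=> X /= => [[Y [AY XY]]|XE]; first exact: isomorphic_trans XY AY.
  exists (cspan (rademacher R)); split; first exact: rademacher_ell1.
  exact: isomorphic_trans XE (isomorphic_sym (rademacher_ell1 R)).
split=> //.
  by have [d Hd] := ccantor_separable R; exact: ell1_class_analytic Hd.
rewrite A_starE => /analytic_souslin/diagonal_tree[T [Ttake Tin Tout]].
have nE : ~ isomorphic (dual (csub_type (tree_space R (tree_code T)))) (ell1 R).
  move=> E; have [x Tx] := Tin E.
  exact: tree_space_branching Tx E.
exact: (nE (tree_space_wf R Ttake (Tout nE))).
Qed.
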